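(* For the Laguerre $\beta$-ensemble with weight $x^{\beta a/2}e^{-\beta x/2}\chi_{x>0}$, $\kappa=\beta/2$, let $\overline W_n^{\rm L}(x_1,\dots,x_n;N,\kappa,a)$ be the $n$-point cumulant generating function (a formal series in $1/x_1,\dots,1/x_n$) with coefficients $\mu^{\rm L}_{p_1,\dots,p_n}(N,\kappa,a)$, extended to general parameter values through these coefficients. Then for every $n\ge1$ $$\overline W_n^{\rm L}(x_1,\dots,x_n;N,\kappa,a)=\overline W_n^{\rm L}(-\kappa x_1,\dots,-\kappa x_n;-\kappa N,\kappa^{-1},-\kappa a).$$ Equivalently, for all nonnegative integers $p_1,\dots,p_n$, $$\mu^{\rm L}_{p_1,\dots,p_n}(N,\kappa,a)=(-\kappa)^{-n-\sum_{l=1}^np_l}\,\mu^{\rm L}_{p_1,\dots,p_n}(-\kappa N,\kappa^{-1},-\kappa a).$$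
   Context: For a positive integer $N$, $\kappa=\beta/2>0$, the Laguerre $\beta$-ensemble here is the probability density on $(0,\infty)^N$ proportional to $$\prod_{l=1}^N\lambda_l^{\kappa a}e^{-\kappa\lambda_l}\prod_{1\le j<k\le N}|\lambda_k-\lambda_j|^{2\kappa}.$$ $\mu^{\rm L}_{p_1,\dots,p_n}(N,\kappa,a)$ is the mixed (joint) cumulant of $\sum_j\lambda_j^{p_1},\dots,\sum_j\lambda_j^{p_n}$ (for $n=1$, the moment $\langle\sum_j\lambda_j^{p_1}\rangle$), and $$\overline W_n^{\rm L}(x_1,\dots,x_n;N,\kappa,a)=\frac1{x_1\cdots x_n}\sum_{p_1,\dots,p_n=0}^\infty\frac{\mu^{\rm L}_{p_1,\dots,p_n}(N,\kappa,a)}{x_1^{p_1}\cdots x_n^{p_n}}.$$ (Equivalently, with $A_i=\sum_j1/(x_i-\lambda_j)$, it is the large-$x$ expansion of $\langle A_1\rangle$ for $n=1$ and of the joint cumulant of $A_1,\dots,A_n$ for $n\ge2$.) For each fixed $\kappa>0$ the coefficients $\mu^{\rm L}_{p_1,\dots,p_n}$ are polynomials in $N$ and $a$, and these polynomials define $\mu^{\rm L}$ and $\overline W_n^{\rm L}$ for general $N,a$, in particular at $(-\kappa N,\kappa^{-1},-\kappa a)$. Identities of generating functions are between formal series. *)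

(* Defs.v *)
(* MathComp / MathComp-Analysis; the reals are an arbitrary [R : realType]. *)
From HB Require Import structures.
From mathcomp Require Import all_boot all_order all_algebra.
From mathcomp Require Import all_classical all_reals all_analysis.

Set Implicit Arguments.
Unset Strict Implicit.
Unset Printing Implicit Defensive.

Import Order.TTheory GRing.Theory Num.Theory.
Import numFieldNormedType.Exports.

Local Open Scope classical_set_scope.
Local Open Scope ring_scope.

(* The integral over (0,+oo)^N as an iterated Lebesgue integral.  It is only
   used below on nonnegative measurable integrands, for which it is the integral
   against the N-dimensional Lebesgue measure (Tonelli). *)
Fixpoint orthant_integral (R : realType) (N : nat) :
    (N.-tuple R -> \bar R) -> \bar R :=
  match N with
  | 0 => fun f => f [tuple]
  | N'.+1 => fun f =>
      (\int[@lebesgue_measure R]_(x in `]0%R, +oo[)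
         @orthant_integral R N' (fun t => f [tuple of x :: t]))%E
  end.

Definition laguerre_weight (R : realType) (N : nat) (kappa a : R)
    (l : N.-tuple R) : R :=
  (\prod_(i < N) (tnth l i `^ (kappa * a) * expR (- (kappa * tnth l i)))) *
  \prod_(j < N) \prod_(k < N | (j < k)%N)
     `|tnth l k - tnth l j| `^ (2 * kappa).

Definition laguerre_mean (R : realType) (N : nat) (kappa a : R)
    (f : N.-tuple R -> R) : R :=
  fine (orthant_integral (fun l => (f l * laguerre_weight kappa a l)%:E)) /
  fine (orthant_integral (fun l : N.-tuple R => (laguerre_weight kappa a l)%:E)).

(* Leonov-Shiryaev formula for the joint cumulant of X_1, ..., X_n (n >= 1),
   [mean] being the expectation operator. *)
Definition joint_cumulant (R : realType) (T : Type) (mean : (T -> R) -> R)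
    (n : nat) (X : 'I_n -> T -> R) : R :=
  \sum_(P : {set {set 'I_n}} | finset.partition P [set: 'I_n]%SET)
     (-1) ^+ #|P|.-1 * (#|P|.-1)`!%:R *
     \prod_(B in P) mean (fun t => \prod_(i in B) X i t).

Definition laguerre_cumulant (R : realType) (n N : nat) (kappa a : R)
    (p : 'I_n -> nat) : R :=
  joint_cumulant (@laguerre_mean R N kappa a)
    (fun i l => \sum_(j < N) tnth l j ^+ p i).

(* The outer variable of [P] stands for a, the inner one for N. *)
Definition eval_Na (R : realType) (P : {poly {poly R}}) (N a : R) : R :=
  P.[a%:P].[N].

(* [-1 < kappa * a] is the condition for the weight to be integrable. *)
Definition laguerre_interpolant (R : realType) (n : nat) (kappa : R)
    (p : 'I_n -> nat) (P : {poly {poly R}}) : Prop :=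
  forall (N : nat) (a : R), (0 < N)%N -> -1 < kappa * a ->
    laguerre_cumulant N kappa a p = eval_Na P N%:R a.

(* mu^L_{p_1,...,p_n}(N, kappa, a) for arbitrary real N and a, through the
   polynomial in N and a that interpolates the cumulants of the ensemble. *)
Definition muL (R : realType) (n : nat) (N kappa a : R) (p : 'I_n -> nat) : R :=
  eval_Na (xget 0 [set P | laguerre_interpolant kappa p P]) N a.

(* Formal series in 1/x_1, ..., 1/x_n: [S k] is the coefficient of
   x_1^(- k_1) ... x_n^(- k_n). *)
Definition inv_series (R : realType) (n : nat) : Type := ('I_n -> nat) -> R.

(* S(c x_1, ..., c x_n) *)
Definition scale_vars (R : realType) (n : nat) (c : R) (S : inv_series R n) :
    inv_series R n :=
  fun k => c ^- (\sum_(i < n) k i) * S k.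

(* The prefactor 1 / (x_1 ... x_n) shifts every exponent by one. *)
Definition WL (R : realType) (n : nat) (N kappa a : R) : inv_series R n :=
  fun k => if [forall i, (0 < k i)%N] then muL N kappa a (fun i => (k i).-1)
           else 0.

Arguments WL {R} n N kappa a _.

(* Main.v *)
(* Integrating the vector field sum_j lambda_j^(k+1) d/dlambda_j against the ensemble
   gives loop equations for the mixed moments m(p_1, ..., p_n):
     kappa m(k+1, p) = ((k+1)(1 - kappa) + kappa a) m(k, p)
       + kappa sum_(m <= k) m(m, k-m, p) + sum_i p_i m(p_1, ..., p_i + k, ..., p_n).
   Together with m(0, p) = N m(p) they determine all moments recursively, as
   polynomials in N and a, and they are invariant under (N, kappa, a) ->
   (- kappa N, 1 / kappa, - kappa a) up to the factor (- kappa)^(n + p_1 + ... + p_n).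
   This factor is multiplicative over set partitions, so cumulants inherit it.

   To avoid the singularities of the derivative of |lambda_k - lambda_j|^(2 kappa) when
   2 kappa < 1, the loop equations are obtained from the changes of variables
   lambda -> lambda + t lambda^(k+1) in all coordinates, as t -> 0+: the Vandermonde
   factor gets multiplied by powers of the smooth factors
   1 + t sum_m lambda_k^(k-m) lambda_j^m. *)
Require Import Defs.
From HB Require Import structures.
From mathcomp Require Import all_boot all_order all_algebra.
From mathcomp Require Import all_classical all_reals all_analysis.
From mathcomp Require Import measurable_realfun zify ring lra.
Import Order.TTheory GRing.Theory Num.Theory.
Import numFieldNormedType.Exports.
Local Open Scope classical_set_scope.
Local Open Scope ring_scope.

Set Implicit Arguments.
Unset Strict Implicit.
Unset Printing Implicit Defensive.

(** * Iterated integrals over the positive orthant *)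

Section orthant_integral.
Context {R : realType}.
Local Notation mu := (@lebesgue_measure R).
Local Notation Rpos := (`]0%R, +oo[%classic : set R).
Local Open Scope ereal_scope.

(** The iterated integral is handled only on integrands that are nonnegative on the orthant, where
    Tonelli gives additivity without integrability conditions. The loop equations have signed terms,
    so each is first obtained as an equality of integrals of two nonnegative functions A and B.
    Differentiation under the integral sign is replaced by inequalities. The deformed integrand is h
    + t (B - A) up to t^2 G, and its integral does not depend on t; integrating, cancelling and
    dividing by t bounds the difference of the integrals of A and B, in both directions, by t times
    the integral of G. Only t in [0, 1] is used: there x + t x^(k+1) maps the half-line increasingly
    onto itself, which fails for t < 0 and k > 0. All errors are dominated by powers of prod (1 +
    l_i), which factorise, together with the one-variable weights, into gamma integrals. The
    recursion for the moments makes sense for all real N and a. It is matched with the ensemble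
    where the weight is integrable, and an infinite grid of integer values of N and a then
    identifies the interpolating polynomial. *)

Definition positive_tuple N (l : N.-tuple R) : Prop := forall i, (0 < tnth l i)%R.

Lemma positive_tuple_cons N x (t : N.-tuple R) :
  (0 < x)%R -> positive_tuple t -> positive_tuple [tuple of x :: t].
Proof.
move=> x0 t0 i; case: (unliftP ord0 i) => [j ->|->].
  by rewrite tnthS.
by rewrite tnth0.
Qed.

Lemma mem_Rpos x : Rpos x -> (0 < x)%R.
Proof. by rewrite /= in_itv /= andbT. Qed.

Lemma eq_orthant_integral N (f g : N.-tuple R -> \bar R) :
  (forall l, positive_tuple l -> f l = g l) ->
  orthant_integral f = orthant_integral g.
Proof.
elim: N f g => [f g fg|N IH f g fg] /=; first by apply: fg => -[].
apply: eq_integral => x /set_mem/mem_Rpos x0; apply: IH => t t0.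
exact/fg/positive_tuple_cons.
Qed.

Lemma orthant_integral_ge0 N (f : N.-tuple R -> \bar R) :
  (forall l, positive_tuple l -> 0 <= f l) -> 0 <= orthant_integral f.
Proof.
elim: N f => [f f0|N IH f f0] /=; first by apply: f0 => -[].
apply: integral_ge0 => x /mem_Rpos x0; apply: IH => t t0.
exact/f0/positive_tuple_cons.
Qed.

(** The parameter space is arbitrary so that induction on [N] can move the first coordinate into the
    parameter; Tonelli then integrates that coordinate out. *)
Lemma measurable_orthant_integral_param d (T : measurableType d) N
    (f : T * N.-tuple R -> \bar R) :
  measurable_fun setT f -> (forall z, 0 <= f z) ->
  measurable_fun [set: T] (fun y => orthant_integral (fun t => f (y, t))).
Proof.
elim: N d T f => [d T f mf f0|N IH d T f mf f0] /=.
  by apply: (measurableT_comp mf); exact: measurable_pair2.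
pose g (z : T * measurableTypeR R) : \bar R :=
  orthant_integral (fun t => f (z.1, [tuple of z.2 :: t])).
have mg : measurable_fun setT g.
  apply: (IH _ _ (fun w : (T * measurableTypeR R) * N.-tuple R =>
    f (w.1.1, [tuple of w.1.2 :: w.2]))).
  - apply: (measurableT_comp mf) => /=.
    apply: measurable_fun_pair => /=.
      exact: (measurableT_comp measurable_fst).
    apply: measurable_cons => /=; last exact: measurable_snd.
    exact: (measurableT_comp measurable_snd).
  - by move=> w; exact: f0.
have g0 z : 0 <= g z by apply: orthant_integral_ge0 => l _; exact: f0.
(* The indicator turns the integral over the half-line into one over the whole line, the form in
   which Tonelli gives measurability. *)
pose h (z : T * measurableTypeR R) : \bar R := g z * (\1_Rpos z.2)%:E.
have mh : measurable_fun setT h.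
  apply: emeasurable_funM => //; apply/measurable_EFinP.
  by apply: (measurableT_comp _ measurable_snd); exact: measurable_indic.
rewrite (_ : (fun y => _) = fubini_F mu h).
  apply: measurable_fun_fubini_tonelli_F => // z.
  by rewrite mule_ge0// lee_fin.
apply/funext => y; rewrite /fubini_F /h [LHS]integral_mkcond.
apply: eq_integral => x _ /=; rewrite patchE indicE /g /=.
by case: (x \in _); rewrite ?mule1 ?mule0.
Qed.

Lemma measurable_tuple_cons N x :
  measurable_fun [set: N.-tuple R] (fun t => [tuple of x :: t]).
Proof. exact: measurable_cons. Qed.

(** Here [f] is nonnegative on the orthant only, while the parametrised version asks for it
    everywhere; truncating by [maxe] does not change the integrals. *)
Lemma measurable_orthant_integral_cons N (f : N.+1.-tuple R -> \bar R) :
  measurable_fun [set: N.+1.-tuple R] f ->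
  (forall l, positive_tuple l -> 0 <= f l) ->
  measurable_fun Rpos
    (fun x : measurableTypeR R => orthant_integral (fun t => f [tuple of x :: t])).
Proof.
move=> mf f0.
pose g (z : measurableTypeR R * N.-tuple R) := maxe (f [tuple of z.1 :: z.2]) 0.
have mg : measurable_fun setT g.
  apply: measurable_maxe => //; apply: (measurableT_comp mf) => /=.
  by apply: measurable_cons => /=; [exact: measurable_fst|exact: measurable_snd].
have g0 z : 0 <= g z by rewrite /g le_max lexx orbT.
have := measurable_orthant_integral_param mg g0.
move=> /(measurable_funS measurableT (@subsetT _ Rpos)).
apply: eq_measurable_fun => x /set_mem/mem_Rpos x0 /=.
apply: eq_orthant_integral => t t0; rewrite /g /= max_l//.
exact/f0/positive_tuple_cons.
Qed.

Let mRpos : measurable (Rpos : set (measurableTypeR R)).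
Proof. exact: measurable_itv. Qed.

Lemma orthant_integralD N (f g : N.-tuple R -> \bar R) :
  measurable_fun [set: N.-tuple R] f -> measurable_fun [set: N.-tuple R] g ->
  (forall l, positive_tuple l -> 0 <= f l) ->
  (forall l, positive_tuple l -> 0 <= g l) ->
  orthant_integral (fun l => f l + g l) = orthant_integral f + orthant_integral g.
Proof.
elim: N f g => [//|N IH f g mf mg f0 g0] /=.
rewrite -ge0_integralD //; last 4 first.
- move=> x /mem_Rpos x0; apply: orthant_integral_ge0 => t t0.
  exact/f0/positive_tuple_cons.
- exact: measurable_orthant_integral_cons.
- move=> x /mem_Rpos x0; apply: orthant_integral_ge0 => t t0.
  exact/g0/positive_tuple_cons.
- exact: measurable_orthant_integral_cons.
apply: eq_integral => x /set_mem/mem_Rpos x0; apply: IH => //.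
- exact: (measurableT_comp mf (@measurable_tuple_cons N x)).
- exact: (measurableT_comp mg (@measurable_tuple_cons N x)).
- by move=> t t0; exact/f0/positive_tuple_cons.
- by move=> t t0; exact/g0/positive_tuple_cons.
Qed.

Lemma orthant_integralZ N (c : \bar R) (f : N.-tuple R -> \bar R) :
  measurable_fun [set: N.-tuple R] f -> 0 <= c ->
  (forall l, positive_tuple l -> 0 <= f l) ->
  orthant_integral (fun l => c * f l) = c * orthant_integral f.
Proof.
elim: N f => [//|N IH f mf c0 f0] /=.
rewrite -ge0_integralZl //; last 2 first.
- exact: measurable_orthant_integral_cons.
- move=> x /mem_Rpos x0; apply: orthant_integral_ge0 => t t0.
  exact/f0/positive_tuple_cons.
apply: eq_integral => x /set_mem/mem_Rpos x0; apply: IH => //.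
- exact: (measurableT_comp mf (@measurable_tuple_cons N x)).
- by move=> t t0; exact/f0/positive_tuple_cons.
Qed.

Lemma le_orthant_integral N (f g : N.-tuple R -> \bar R) :
  measurable_fun [set: N.-tuple R] f -> measurable_fun [set: N.-tuple R] g ->
  (forall l, positive_tuple l -> 0 <= f l) ->
  (forall l, positive_tuple l -> f l <= g l) ->
  orthant_integral f <= orthant_integral g.
Proof.
elim: N f g => [f g _ _ _|N IH f g mf mg f0 fg] /=; first by apply=> -[].
have g0 l : positive_tuple l -> 0 <= g l.
  by move=> l0; exact: le_trans (f0 _ l0) (fg _ l0).
apply: ge0_le_integral => //.
- move=> x /mem_Rpos x0; apply: orthant_integral_ge0 => t t0.
  exact/f0/positive_tuple_cons.
- exact: measurable_orthant_integral_cons.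
- exact: measurable_orthant_integral_cons.
- move=> x /mem_Rpos x0; apply: IH => //.
  + exact: (measurableT_comp mf (@measurable_tuple_cons N x)).
  + exact: (measurableT_comp mg (@measurable_tuple_cons N x)).
  + by move=> t t0; exact/f0/positive_tuple_cons.
  + by move=> t t0; exact/fg/positive_tuple_cons.
Qed.

Lemma orthant_integral_prod N (g : 'I_N -> R -> R) :
  (forall i, measurable_fun [set: R] (g i)) ->
  (forall i x, (0 < x)%R -> (0 <= g i x)%R) ->
  orthant_integral (fun l : N.-tuple R => (\prod_(i < N) g i (tnth l i))%:E) =
  \prod_(i < N) \int[mu]_(x in Rpos) (g i x)%:E.
Proof.
elim: N g => [|N IH] g mg g0 /=; first by rewrite !big_ord0.
have I0 i : 0 <= \int[mu]_(x in Rpos) (g i x)%:E.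
  by apply: integral_ge0 => x /mem_Rpos x0; rewrite lee_fin g0.
rewrite big_ord_recl -IH//; last by move=> i; exact: g0.
set K := orthant_integral _.
have K0 : 0 <= K.
  apply: orthant_integral_ge0 => l l0.
  by rewrite lee_fin prodr_ge0// => i _; exact: g0.
rewrite muleC -ge0_integralZl//; last 2 first.
- by apply: measurable_funTS; apply/measurable_EFinP; exact: mg.
- by move=> x /mem_Rpos x0; rewrite lee_fin g0.
apply: eq_integral => x /set_mem/mem_Rpos x0; rewrite muleC.
rewrite -orthant_integralZ//; last 3 first.
- apply/measurable_EFinP; apply: measurable_prod => i _.
  exact: (measurableT_comp (mg _) (measurable_tnth _)).
- by rewrite lee_fin g0.
- by move=> l l0; rewrite lee_fin prodr_ge0// => i _; exact: g0.
apply: eq_orthant_integral => t t0; rewrite big_ord_recl tnth0 EFinM.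
by under eq_bigr do rewrite tnthS.
Qed.

(** The change of variables acts on each coordinate separately, so its Jacobian is a product and the
    one-dimensional formula is applied once per coordinate. [subst1] ranges over all measurable [g]
    because the integrand in one coordinate is itself an integral over the remaining ones. *)
Lemma orthant_integral_subst N (phi dphi : R -> R) (f : N.-tuple R -> \bar R) :
  measurable_fun [set: R] phi -> measurable_fun [set: R] dphi ->
  (forall x, (0 < x)%R -> (0 < phi x)%R) -> (forall x, (0 < x)%R -> (0 <= dphi x)%R) ->
  (forall g : R -> \bar R, measurable_fun Rpos g ->
     (forall x, Rpos x -> 0 <= g x) ->
     \int[mu]_(x in Rpos) g x = \int[mu]_(x in Rpos) ((dphi x)%:E * g (phi x))) ->
  measurable_fun [set: N.-tuple R] f ->
  (forall l, positive_tuple l -> 0 <= f l) ->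
  orthant_integral f =
  orthant_integral (fun l =>
    (\prod_(i < N) dphi (tnth l i))%:E * f [tuple of map phi l]).
Proof.
move=> mphi mdphi phi0 dphi0 subst1.
have mmap n : measurable_fun [set: n.-tuple R] (fun l => [tuple of map phi l]).
  apply/measurable_fun_tnthP => i /=.
  rewrite (_ : _ \o _ = phi \o (@tnth _ R ^~ i)).
    exact: (measurableT_comp mphi (measurable_tnth _)).
  by apply/funext => l /=; rewrite tnth_map.
have map_pos n (l : n.-tuple R) : positive_tuple l -> positive_tuple [tuple of map phi l].
  by move=> l0 i; rewrite tnth_map phi0.
elim: N f => [f mf f0 /=|N IH f mf f0 /=].
  by rewrite big_ord0 mul1e; congr f; apply: val_inj.
rewrite subst1//; last 2 first.
- exact: measurable_orthant_integral_cons.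
- move=> x /mem_Rpos x0; apply: orthant_integral_ge0 => t t0.
  exact/f0/positive_tuple_cons.
apply: eq_integral => x /set_mem/mem_Rpos x0.
have mfc y : measurable_fun [set: N.-tuple R] (fun t => f [tuple of y :: t]).
  exact: (measurableT_comp mf (@measurable_tuple_cons N y)).
have fc0 y t : (0 < y)%R -> positive_tuple t -> 0 <= f [tuple of y :: t].
  by move=> y0 t0; exact/f0/positive_tuple_cons.
rewrite IH//; last by move=> t; apply: fc0; exact: phi0.
rewrite -orthant_integralZ//; last 3 first.
- apply: emeasurable_funM.
    apply/measurable_EFinP; apply: measurable_prod => i _.
    exact: (measurableT_comp mdphi (measurable_tnth _)).
  exact: (measurableT_comp (mfc _) (mmap N)).
- by rewrite lee_fin dphi0.
- move=> t t0; apply: mule_ge0.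
    by rewrite lee_fin prodr_ge0// => i _; exact: dphi0.
  by apply: fc0; [exact: phi0|exact: map_pos].
apply: eq_orthant_integral => t t0.
rewrite muleA -EFinM big_ord_recl tnth0.
under [in RHS]eq_bigr do rewrite tnthS.
by congr (_ * f _); apply: val_inj.
Qed.

End orthant_integral.

(** * One-dimensional change of variables *)

Section substitution.
Context {R : realType}.
Local Notation mu := (@lebesgue_measure R).
Local Notation Rpos := (`]0%R, +oo[%classic : set (measurableTypeR R)).
Local Notation Rnpos := (`]-oo, 0%R]%classic : set (measurableTypeR R)).
Variables phi dphi : R -> R.
Hypothesis dphiP : forall x : R, is_derive x 1 phi (dphi x).
Hypothesis cdphi : continuous dphi.
Hypothesis dphi_ge0 : forall x, 0 <= x -> 0 <= dphi x.
Hypothesis phi0 : phi 0 = 0.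
Hypothesis phi_ge : forall x, 0 <= x -> x <= phi x.
Hypothesis phi_incr : forall x y, 0 <= x -> x < y -> phi x < phi y.

Let phi_ler x y : 0 <= x -> 0 <= y -> (phi x <= phi y) = (x <= y).
Proof.
move=> x0 y0; case: (leP x y) => [|yx].
  by rewrite le_eqVlt => /predU1P[->|/(phi_incr x0)/ltW]; rewrite ?lexx.
by apply/negbTE; rewrite -ltNge; apply: phi_incr.
Qed.

Let phi_ltr x y : 0 <= x -> 0 <= y -> (phi x < phi y) = (x < y).
Proof. by move=> x0 y0; rewrite !ltNge phi_ler. Qed.

Let phi_gt0 x : (0 < x) -> 0 < phi x.
Proof. by move=> x0; rewrite -phi0 phi_ltr// ltW. Qed.

Let cphi : continuous phi.
Proof.
move=> x; apply: differentiable_continuous; apply/derivable1_diffP.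
by have [] := dphiP x.
Qed.

Let mphi : measurable_fun [set: R] phi.
Proof. exact: continuous_measurable_fun. Qed.

Let mdphi : measurable_fun [set: R] dphi.
Proof. exact: continuous_measurable_fun. Qed.

(** [phi_ge] puts [a] between [phi 0] and [phi a], so the intermediate value theorem applies on
    [0, a] and no limit at infinity is needed. *)
Let phi_surj a : 0 <= a -> exists2 c, 0 <= c & phi c = a.
Proof.
move=> a0; have : Num.min (phi 0) (phi a) <= a <= Num.max (phi 0) (phi a).
  by rewrite phi0 min_l ?max_r ?a0 ?phi_ge// (le_trans a0)// phi_ge.
case/(@IVT _ phi 0 a a a0) => [|c]; first exact: continuous_subspaceT.
by rewrite in_itv /= => /andP[c0 _] <-; exists c.
Qed.

(* The pushforward of the planar Lebesgue measure of the subgraph of [dphi] along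
   the abscissa followed by [phi] is the Lebesgue measure. *)
Let graph_map (z : measurableTypeR R * measurableTypeR R) : measurableTypeR R :=
  if [&& 0 < z.1, 0 < z.2 & z.2 < dphi z.1] then phi z.1 else 0.

Let mcond : measurable_fun setT
  (fun z : measurableTypeR R * measurableTypeR R => [&& 0 < z.1, 0 < z.2 & z.2 < dphi z.1]).
Proof.
apply: measurable_and; last apply: measurable_and.
- exact: measurable_fun_ltr (measurable_cst _) measurable_fst.
- exact: measurable_fun_ltr (measurable_cst _) measurable_snd.
- apply: measurable_fun_ltr measurable_snd _.
  exact: (measurableT_comp mdphi measurable_fst).
Qed.

Let mgraph_map : measurable_fun setT graph_map.
Proof.
apply: measurable_fun_ifT => //.
exact: (measurableT_comp mphi measurable_fst).
Qed.

Let mRpos : measurable Rpos. Proof. exact: measurable_itv. Qed.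
Let mRnpos : measurable Rnpos. Proof. exact: measurable_itv. Qed.

(** With phi c = a and phi d = b, the section over u is the interval from 0 to dphi u when c < u <=
    d. Otherwise it is empty, since points off the subgraph go to 0, which is not in []a, b]]. The
    area is thus the integral of dphi over [c, d], given by the fundamental theorem of calculus. *)
Let pushforward_itv (a b : R) : 0 <= a -> a <= b ->
  pushforward (mu \x mu)%E graph_map `]a, b]%classic = (b - a)%:E.
Proof.
move=> a0; rewrite le_eqVlt => /predU1P[<-|ab].
  by rewrite set_itvoc0 measure0 ?subrr.
have b0 : 0 <= b by rewrite (le_trans a0)// ltW.
have [c c0 ca] := phi_surj a0; have [d d0 db] := phi_surj b0.
have cd : c < d by rewrite -phi_ltr// ca db.
rewrite /pushforward /product_measure1 /=.
transitivity (\int[mu]_(u in `[c, d]) (dphi u)%:E)%E; last first.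
  rewrite (@continuous_FTC2 _ dphi phi)//.
  - by rewrite ca db -EFinB.
  - exact: continuous_subspaceT.
  - split=> [x _||]; first by have [] := dphiP x.
    + by apply: cvg_at_right_filter; exact: cphi.
    + by apply: cvg_at_left_filter; exact: cphi.
  - by move=> x _; rewrite derive1E; have [_ ->] := dphiP x.
rewrite -integral_itv_obnd_cbnd; last first.
  by apply: measurable_funTS; exact/measurable_EFinP.
rewrite [RHS]integral_mkcond; apply: eq_integral => u _; rewrite patchE /=.
rewrite mem_setE in_itv /=; case: ifPn => [/andP[cu ud]|cud].
  have u0 : 0 < u by exact: le_lt_trans cu.
  rewrite (_ : xsection _ _ = `]0, dphi u[%classic).
    rewrite lebesgue_measure_itv /= lte_fin oppr0 adde0.
    case: ltP => // du; congr EFin; apply/esym/eqP.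
    by rewrite eq_le du dphi_ge0// ltW.
  apply/seteqP; split => y; rewrite xsectionP /graph_map /= u0 in_itv /=.
    by case: ifP => // _; rewrite in_itv/= ltNge a0.
  by move=> ->; rewrite in_itv/= -ca -db phi_ltr ?phi_ler ?cu// ltW.
rewrite (_ : xsection _ _ = set0) ?measure0//.
apply/seteqP; split => y //; rewrite xsectionP /graph_map /=.
case: ifP => [/andP[u0 _]|_]; rewrite in_itv/=; last by rewrite ltNge a0.
by rewrite -ca -db phi_ltr ?phi_ler ?(negbTE cud)// ltW.
Qed.

(** Lebesgue measure is glued on over the nonpositive half-line, which yields a measure on the whole
    line; it can then be identified by its values on half-open intervals. *)
Let graph_measure : {measure set (measurableTypeR R) -> \bar R}.
Proof.
unshelve refine (measure_add
  (mrestr (pushforward (mu \x mu)%E graph_map) mRpos) (mrestr mu mRnpos)).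
exact: mgraph_map.
Defined.

Let graph_measureX A : graph_measure A =
  (pushforward (mu \x mu) graph_map (A `&` Rpos) + mu (A `&` Rnpos))%E.
Proof. exact: measure_addE. Qed.

Let graph_measureE A : measurable A -> mu A = graph_measure A.
Proof.
apply: lebesgue_measure_unique => X [[a b] _ <-]; rewrite [RHS]graph_measureX /=.
have [ba|ab] := leP b a.
  rewrite set_itv_ge ?bnd_simp -?leNgt// !set0I /pushforward preimage_set0.
  by rewrite !measure0 adde0.
have -> : (`]a, b] `&` Rpos = `]Num.max a 0, Num.max b 0])%classic.
  apply/seteqP; split => x /=; rewrite !in_itv/= ?andbT gt_max le_max.
    by move=> [/andP[-> ->] ->].
  by case/andP => /andP[-> x0] /orP[->//|]; rewrite leNgt x0.
have -> : (`]a, b] `&` Rnpos = `]Num.min a 0, Num.min b 0])%classic.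
  apply/seteqP; split => x /=; rewrite !in_itv/= gt_min le_min.
    by move=> [/andP[-> ->] ->].
  by case/andP => /orP[->|x0] /andP[-> x0'] //; move: x0; rewrite ltNge x0'.
rewrite pushforward_itv; [|by rewrite le_max lexx orbT|
  by rewrite ge_max !le_max lexx (ltW ab) orbT].
rewrite !lebesgue_measure_itv /= !lte_fin ab.
have := minr_to_max a 0; have := minr_to_max b 0.
have : Num.min a 0 <= Num.min b 0 by rewrite le_min !ge_min lexx (ltW ab) orbT.
by case: ltP => H; rewrite -?EFinB -?EFinD ?adde0 => *; congr EFin; lra.
Qed.

(** The left side is an integral against the pushforward, hence a planar integral over the subgraph
    of [dphi]. Integrating the ordinate first, by Tonelli, gives the factor dphi u. *)
Lemma ge0_integral_subst_Rpos (g : R -> \bar R) :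
  measurable_fun Rpos g -> (forall x, Rpos x -> (0 <= g x)%E) ->
  (\int[mu]_(x in Rpos) g x = \int[mu]_(x in Rpos) ((dphi x)%:E * g (phi x)))%E.
Proof.
move=> mg g0.
transitivity (\int[pushforward (mu \x mu) graph_map]_(x in Rpos) g x)%E.
  apply: eq_measure_integral => A mA AR.
  transitivity (graph_measure A); first exact: graph_measureE.
  rewrite graph_measureX setIidl//.
  rewrite (_ : A `&` Rnpos = set0) ?measure0 ?adde0//.
  apply/seteqP; split => x //= [/AR]; rewrite /= !in_itv/= andbT => x0.
  by rewrite leNgt x0.
rewrite ge0_integral_pushforward//; last by move=> x /set_mem; exact: g0.
rewrite integral_mkcond.
pose h (z : measurableTypeR R * measurableTypeR R) := ((g \_ Rpos) (graph_map z))%E.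
have g0' x : (0 <= (g \_ Rpos) x)%E.
  by rewrite patchE; case: ifPn => // /set_mem; exact: g0.
have mg' : measurable_fun setT (g \_ Rpos).
  exact/(measurable_restrictT g mRpos).
transitivity (\int[mu \x mu]_z h z)%E.
  apply: eq_integral => z _; rewrite /h !patchE.
  by rewrite !mem_setE.
rewrite fubini_tonelli1; last 2 first.
- exact: (measurableT_comp mg' mgraph_map).
- by move=> z; exact: g0'.
rewrite [RHS]integral_mkcond; apply: eq_integral => u _.
rewrite /fubini_F /h patchE mem_setE /= in_itv /= andbT /graph_map /=.
case: ifPn => u0 /=; last first.
  by apply: integral0_eq => y _; rewrite patchE mem_setE /= in_itv/= ltxx.
transitivity (\int[mu]_y (g (phi u) * (\1_`]0, dphi u[ y)%:E))%E.
  apply: eq_integral => y _; rewrite indicE mem_setE /= in_itv /=.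
  rewrite patchE mem_setE /= in_itv/= andbT.
  by case: (_ < y < _); rewrite ?mule1 ?mule0 ?ltxx ?phi_gt0.
rewrite ge0_integralZl//; last 2 first.
- by apply/measurable_EFinP; exact: measurable_indic.
- by apply: g0; rewrite /= in_itv/= andbT phi_gt0.
rewrite integral_indic// setIT -[X in (_ * X)%E]/(mu `]0, dphi u[%classic).
rewrite lebesgue_measure_itv /= lte_fin oppr0 adde0 muleC.
case: ltP => // du; rewrite (_ : dphi u = 0)//.
by apply/eqP; rewrite eq_le du dphi_ge0// ltW.
Qed.

End substitution.

(** * Gamma integrals *)

Section gamma_integral.
Context {R : realType}.
Local Notation mu := (@lebesgue_measure R).
Local Notation Rpos := (`]0%R, +oo[%classic : set (measurableTypeR R)).

Lemma is_derive_powR (r x : R) : 0 < x ->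
  is_derive x (1 : R) (fun y => y `^ r) (r * x `^ (r - 1)).
Proof.
move=> x0; have xI : x \in `]0, +oo[ by rewrite in_itv/= x0.
split; first exact: derivable_powR.
by rewrite -derive1E powR_derive1.
Qed.

(** Beta-prime density with parameters b and 1. It has the same kind of power singularity at 0 as a
    gamma density, decays like x^-2 at infinity and has an explicit antiderivative, so it serves as
    an integrable majorant. *)
Let beta_density (b x : R) := b * (x `^ (b - 1) * (x + 1) `^ (- b - 1)).

(* (x / (1 + x))^b, an antiderivative of [beta_density b] with values in [0, 1]. *)
Let beta_cdf (b x : R) := x `^ b * (x + 1) `^ (- b).

Let is_derive_beta (b x : R) : 0 < x ->
  is_derive x (1 : R) (beta_cdf b) (beta_density b x).
Proof.
move=> x0; have x1 : 0 < x + 1 by rewrite addr_gt0.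
have d1 := is_derive_powR b x0.
have d2 := @is_derive1_comp _ (fun y => y `^ (- b)) (shift 1) x _ _
  (is_derive_powR (- b) x1) (is_derive_shift x 1 1).
apply: (is_derive_eq (is_deriveM d1 d2)).
have xn : x != 0 by rewrite gt_eqF.
have x1n : x + 1 != 0 by rewrite gt_eqF.
rewrite /= /beta_density !powRB ?xn ?x1n ?implybT// !powRr1 ?ltW// /GRing.scale /=.
by field; rewrite x1n xn.
Qed.

Let continuous_within_beta (b u v : R) : 0 < u ->
  {within `[u, v], continuous (beta_density b)}.
Proof.
move=> u0; apply: derivable_within_continuous => x.
rewrite in_itv/= => /andP[ux _]; have x0 : 0 < x by exact: lt_le_trans ux.
have x1 : 0 < x + 1 by rewrite addr_gt0.
have d1 := is_derive_powR (b - 1) x0.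
have d2 := @is_derive1_comp _ (fun y => y `^ (- b - 1)) (shift 1) x _ _
  (is_derive_powR (- b - 1) x1) (is_derive_shift x 1 1).
have d3 := is_derive_cst b x (1 : R).
by have [] := is_deriveM d3 (is_deriveM d1 d2).
Qed.

Let measurable_beta b : measurable_fun [set: R] (beta_density b).
Proof.
apply: measurable_funM => //; apply: measurable_funM => //.
apply: (measurableT_comp (measurable_powR _)).
exact: measurable_funD.
Qed.

Let beta_ge0 b x : 0 <= b -> 0 <= beta_density b x.
Proof. by move=> b0; rewrite !mulr_ge0 ?powR_ge0. Qed.

Let beta_cdf_le1 b x : 0 <= b -> 0 < x -> beta_cdf b x <= 1.
Proof.
move=> b0 x0; have x1 : 0 < x + 1 by rewrite addr_gt0.
rewrite /beta_cdf powRN ler_pdivrMr ?powR_gt0// mul1r.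
by apply: ge0_ler_powR; rewrite ?nnegrE ?lerDl// ltW.
Qed.

Let beta_integral_itv (b u v : R) : 0 <= b -> 0 < u -> u < v ->
  (\int[mu]_(x in `[u, v]) (beta_density b x)%:E <= 1)%E.
Proof.
move=> b0 u0 uv; have v0 : 0 < v by exact: lt_trans uv.
have cont x : 0 < x -> {for x, continuous (beta_cdf b)}.
  move=> x0; apply: differentiable_continuous; apply/derivable1_diffP.
  by have [] := is_derive_beta b x0.
rewrite (@continuous_FTC2 _ _ (beta_cdf b))//.
- rewrite -EFinB lee_fin lerBlDr (le_trans (beta_cdf_le1 b0 v0))//.
  by rewrite lerDl mulr_ge0 ?powR_ge0.
- exact: continuous_within_beta.
- split=> [x||].
  + rewrite in_itv/= => /andP[ux _].
    by have [] := is_derive_beta b (lt_trans u0 ux).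
  + by apply: cvg_at_right_filter; exact: cont.
  + by apply: cvg_at_left_filter; exact: cont.
- move=> x; rewrite in_itv/= => /andP[ux _].
  by rewrite derive1E; have [_ ->] := is_derive_beta b (lt_trans u0 ux).
Qed.

Let beta_integral (b : R) : 0 <= b ->
  (\int[mu]_(x in Rpos) (beta_density b x)%:E <= 1)%E.
Proof.
(* Exhaustion by compact intervals for monotone convergence. The shift by 2 keeps the endpoints
   distinct already at n = 0, as [beta_integral_itv] requires. *)
move=> b0; pose F (n : nat) : set (measurableTypeR R) := `[n.+2%:R^-1, n.+2%:R]%classic.
have -> : Rpos = \bigcup_n F n.
  apply/seteqP; split => x /=.
    rewrite in_itv/= andbT => x0.
    exists (maxn (Num.bound x) (Num.bound x^-1)) => //.
    rewrite /F /= in_itv/=.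
    have le y : 0 < y -> (Num.bound y <= maxn (Num.bound x) (Num.bound x^-1))%N ->
        y <= (maxn (Num.bound x) (Num.bound x^-1)).+2%:R.
      move=> y0 yb; apply: (le_trans (ltW (archi_boundP (ltW y0)))).
      by rewrite ler_nat (leq_trans yb)// -addn2 leq_addr.
    by rewrite le ?leq_maxl// invf_ple ?posrE// le ?invr_gt0 ?leq_maxr.
  by move=> [n _]; rewrite /F /= !in_itv/= andbT => /andP[+ _]; apply: lt_le_trans.
have cvgF : (\int[mu]_(x in F i) (beta_density b x)%:E)%E @[i --> \oo] -->
    (\int[mu]_(x in \bigcup_i F i) (beta_density b x)%:E)%E.
  apply: ge0_nondecreasing_set_cvg_integral.
  - move=> n m nm; rewrite subsetEset /F => x /=.
    rewrite !in_itv/= => /andP[ax xb]; apply/andP; split.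
      by rewrite (le_trans _ ax)// lef_pV2 ?posrE// ler_nat.
    by rewrite (le_trans xb)// ler_nat.
  - by move=> n; exact: measurable_itv.
  - by move=> n; apply: measurable_funTS; apply/measurable_EFinP; exact: measurable_beta.
  - by move=> n x _; rewrite lee_fin beta_ge0.
apply: (cvge_le _ cvgF); apply: nearW => n.
apply: beta_integral_itv => //; rewrite ?invr_gt0//.
by rewrite (@lt_le_trans _ _ 1)// ?invf_lt1// ?ltr1n ?ler1n.
Qed.

Lemma polynomial_expR_bound (s : R) n : 0 < s ->
  exists2 C : R, 0 <= C & forall x, 0 <= x -> (1 + x) ^+ n * expR (- (s * x)) <= C.
Proof.
move=> s0; case: n => [|n].
  exists 1 => // x x0; rewrite expr0 mul1r -expR0 ler_expR oppr_le0.
  by rewrite mulr_ge0// ltW.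
(* Chosen so that 1 + x <= c (1 + s x / (n+1)), which is at most c exp(s x / (n+1)); the power n+1
   of this inequality is the claim. *)
pose c := 1 + n.+1%:R / s.
have c0 : 0 < c by rewrite addr_gt0// divr_gt0.
exists (c ^+ n.+1) => [|x x0]; first by rewrite exprn_ge0 ?ltW.
have H : 1 + x <= c * expR (s / n.+1%:R * x).
  apply: (@le_trans _ _ (c * (1 + s / n.+1%:R * x))); last first.
    by rewrite ler_pM2l// expR_ge1Dx.
  rewrite /c mulrDl mul1r mulrDr mulr1 [in X in _ <= _ + X]mulrA.
  rewrite (_ : n.+1%:R / s * (s / n.+1%:R) = 1); last first.
    by field; rewrite (gt_eqF s0) nat1r pnatr_eq0.
  have : 0 <= n.+1%:R / s by rewrite divr_ge0// ltW.
  have : 0 <= s / n.+1%:R * x by rewrite mulr_ge0// divr_ge0// ltW.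
  by move: (s / _ * x) (_ / s) => u v; lra.
have {}H : (1 + x) ^+ n.+1 <= c ^+ n.+1 * expR (s * x).
  apply: (@le_trans _ _ ((c * expR (s / n.+1%:R * x)) ^+ n.+1)).
    by rewrite lerXn2r ?nnegrE ?addr_ge0 ?mulr_ge0 ?expR_ge0// ltW.
  rewrite exprMn -expRM_natr ler_pM2l ?exprn_gt0//.
  by rewrite ler_expR mulrAC divfK.
by rewrite expRN ler_pdivrMr ?expR_gt0.
Qed.

Lemma gamma_integral_lty (kappa b : R) d : 0 < kappa -> -1 < b ->
  (\int[mu]_(x in Rpos) (x `^ b * expR (- (kappa * x)) * (1 + x) ^+ d)%:E < +oo)%E.
Proof.
move=> k0 b1; have b0 : 0 < b + 1 by rewrite -ltrBlDr sub0r.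
(* The majorant will be [beta_density (b + 1)], which is (b + 1) x^b (1 + x)^-(b+2). The extra
   integer exponent, at least b + 2, pays for its denominator. *)
have [C C0 HC] := polynomial_expR_bound (d + Num.bound (b + 2)) k0.
have mg : measurable_fun [set: R] (fun x => x `^ b * expR (- (kappa * x)) * (1 + x) ^+ d).
  apply: measurable_funM; first apply: measurable_funM => //.
    apply: measurableT_comp => //.
    by apply: measurableT_comp => //; exact: measurable_funM.
  by apply: measurable_funX; exact: measurable_funD.
apply: (@le_lt_trans _ _ (\int[mu]_(x in Rpos) ((C / (b + 1))%:E * (beta_density (b + 1) x)%:E)))%E.
  apply: ge0_le_integral => //.
  - move=> x; rewrite /= in_itv/= andbT => x0; rewrite lee_fin.
    by rewrite !mulr_ge0 ?powR_ge0 ?expR_ge0 ?exprn_ge0 ?addr_ge0// ltW.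
  - by apply: measurable_funTS; apply/measurable_EFinP.
  - apply: measurable_funTS; apply: emeasurable_funM => //.
    apply/measurable_EFinP; exact: measurable_beta.
  - move=> x; rewrite /= in_itv/= andbT => x0; rewrite -EFinM lee_fin.
    have x1 : 1 <= x + 1 by rewrite lerDr ltW.
    rewrite /beta_density addrK [leRHS](_ : _ =
      x `^ b * (C * (x + 1) `^ (- (b + 1) - 1))); last first.
      by field; rewrite gt_eqF.
    rewrite -mulrA ler_wpM2l ?powR_ge0// (_ : - (b + 1) - 1 = - (b + 2)); last by ring.
    rewrite powRN ler_pdivlMr ?powR_gt0//; last by rewrite (lt_le_trans _ x1).
    apply: le_trans (HC x (ltW x0)).
    rewrite exprD (mulrC (expR _)) mulrAC -!mulrA ler_pM2l ?exprn_gt0 ?addr_gt0//.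
    rewrite ler_pM2r ?expR_gt0// (addrC 1 x) -powR_mulrn ?(le_trans _ x1)//.
    apply: ler_powR => //; apply/ltW/archi_boundP.
    by move: b0; lra.
rewrite ge0_integralZl_EFin//; last 3 first.
- by move=> x _; rewrite lee_fin beta_ge0// ltW.
- by apply: measurable_funTS; apply/measurable_EFinP; exact: measurable_beta.
- by rewrite divr_ge0// ltW.
apply: (@le_lt_trans _ _ (C / (b + 1))%:E); last by rewrite ltry.
rewrite -[leRHS]mule1 lee_pmul//; last by rewrite beta_integral// ltW.
- by rewrite lee_fin divr_ge0// ltW.
- by apply: integral_ge0 => x _; rewrite lee_fin beta_ge0// ltW.
Qed.

End gamma_integral.

(** * Integrability of the Laguerre weight *)

Section poly_bounded.
Context {R : realType} {N : nat}.
Implicit Types f g : N.-tuple R -> R.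

(** A gauge that is at least 1 on the orthant, dominates every coordinate and, being a product over
    coordinates, keeps the dominating integrals factorised. *)
Definition growth (l : N.-tuple R) : R := \prod_(i < N) (1 + tnth l i).

Lemma growth_ge1 l : positive_tuple l -> 1 <= growth l.
Proof.
by rewrite /growth => l0; elim/big_ind: _ => // [*|i _]; [exact: mulr_ege1|rewrite lerDl ltW].
Qed.

Lemma le_growth l i : positive_tuple l -> tnth l i <= growth l.
Proof.
move=> l0; rewrite /growth (bigD1 i)//=.
have H : 1 <= \prod_(j < N | j != i) (1 + tnth l j).
  by elim/big_ind: _ => // [*|j _]; [exact: mulr_ege1|rewrite lerDl ltW].
apply: (@le_trans _ _ (1 + tnth l i)); first by rewrite lerDr.
by rewrite ler_peMr// addr_ge0// ltW.
Qed.

Definition poly_bounded f := exists C d, 0 <= C /\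
  forall l, positive_tuple l -> `|f l| <= C * growth l ^+ d.

Lemma poly_bounded_le f g : poly_bounded g ->
  (forall l, positive_tuple l -> `|f l| <= `|g l|) -> poly_bounded f.
Proof.
by move=> [C [d [C0 H]]] fg; exists C, d; split=> // l l0; rewrite (le_trans (fg _ l0)) ?H.
Qed.

Lemma poly_bounded_cst c : poly_bounded (fun=> c).
Proof.
by exists `|c|, 0%N; split => // l l0; rewrite expr0 mulr1.
Qed.

Lemma poly_bounded_tnth i : poly_bounded (fun l => tnth l i).
Proof.
exists 1, 1%N; split => // l l0; rewrite expr1 mul1r ger0_norm ?le_growth//.
exact: ltW.
Qed.

Lemma poly_boundedD f g : poly_bounded f -> poly_bounded g ->
  poly_bounded (fun l => f l + g l).
Proof.
move=> [C [c [C0 Hf]]] [D [d [D0 Hg]]]; exists (C + D), (c + d)%N.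
split=> [|l l0]; first exact: addr_ge0.
have G := growth_ge1 l0; rewrite mulrDl (le_trans (ler_normD _ _))//.
apply: lerD.
  by rewrite (le_trans (Hf _ l0))// ler_wpM2l// ler_weXn2l// leq_addr.
by rewrite (le_trans (Hg _ l0))// ler_wpM2l// ler_weXn2l// leq_addl.
Qed.

Lemma poly_boundedM f g : poly_bounded f -> poly_bounded g ->
  poly_bounded (fun l => f l * g l).
Proof.
move=> [C [c [C0 Hf]]] [D [d [D0 Hg]]]; exists (C * D), (c + d)%N.
split=> [|l l0]; first exact: mulr_ge0.
by rewrite exprD mulrACA normrM ler_pM ?Hf ?Hg.
Qed.

Lemma poly_bounded_norm f : poly_bounded f -> poly_bounded (fun l => `|f l|).
Proof. by move=> H; apply: poly_bounded_le H _ => l _; rewrite normr_id. Qed.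

Lemma poly_boundedN f : poly_bounded f -> poly_bounded (fun l => - f l).
Proof. by move=> H; apply: poly_bounded_le H _ => l _; rewrite normrN. Qed.

Lemma poly_bounded_sum (I : Type) (r : seq I) (P : pred I) (F : I -> N.-tuple R -> R) :
  (forall i, P i -> poly_bounded (F i)) ->
  poly_bounded (fun l => \sum_(i <- r | P i) F i l).
Proof.
move=> H; elim: r => [|i r IH].
  by under eq_fun do rewrite big_nil; exact: poly_bounded_cst.
have [Pi|nPi] := boolP (P i); last by under eq_fun do rewrite big_cons (negbTE nPi).
under eq_fun do rewrite big_cons Pi.
exact: poly_boundedD (H _ Pi) IH.
Qed.

Lemma poly_bounded_prod (I : Type) (r : seq I) (P : pred I) (F : I -> N.-tuple R -> R) :
  (forall i, P i -> poly_bounded (F i)) ->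
  poly_bounded (fun l => \prod_(i <- r | P i) F i l).
Proof.
move=> H; elim: r => [|i r IH].
  by under eq_fun do rewrite big_nil; exact: poly_bounded_cst.
have [Pi|nPi] := boolP (P i); last by under eq_fun do rewrite big_cons (negbTE nPi).
under eq_fun do rewrite big_cons Pi.
exact: poly_boundedM (H _ Pi) IH.
Qed.

Lemma poly_boundedX f n : poly_bounded f -> poly_bounded (fun l => f l ^+ n).
Proof.
move=> H; elim: n => [|n IH].
  by under eq_fun do rewrite expr0; exact: poly_bounded_cst.
by under eq_fun do rewrite exprS; exact: poly_boundedM.
Qed.

(** Needed for the real exponent of the Vandermonde factor: replacing |f| by 1 + |f| >= 1 allows the
    exponent to be rounded up to an integer. *)
Lemma poly_bounded_powR f r : 0 <= r -> poly_bounded f ->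
  poly_bounded (fun l => `|f l| `^ r).
Proof.
move=> r0 H.
apply: poly_bounded_le (poly_boundedX (Num.bound r)
  (poly_boundedD (poly_bounded_cst 1) (poly_bounded_norm H))) _ => l _.
have G : 1 <= 1 + `|f l| by rewrite lerDl.
rewrite [leLHS]ger0_norm ?powR_ge0// [leRHS]ger0_norm ?exprn_ge0 ?addr_ge0//.
apply: (@le_trans _ _ ((1 + `|f l|) `^ r)).
  by apply: ge0_ler_powR; rewrite ?nnegrE ?addr_ge0 ?lerDr.
by rewrite -powR_mulrn ?addr_ge0// ler_powR// ltW// archi_boundP.
Qed.

End poly_bounded.

Section weight.
Context {R : realType} {N : nat}.
Variables (kappa a : R).
Hypotheses (kappa0 : 0 < kappa) (a1 : -1 < kappa * a).
Local Notation w := (@laguerre_weight R N kappa a).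

Let measurable_prod_cond (I : finType) (P : pred I) (F : I -> N.-tuple R -> R) :
  (forall i, P i -> measurable_fun setT (F i)) ->
  measurable_fun setT (fun l => \prod_(i | P i) F i l).
Proof.
move=> H.
rewrite (_ : (fun l => \prod_(i | P i) F i l) = fun l => \prod_i (if P i then F i l else 1)).
  by apply: measurable_prod => i _; move: (H i); case: (P i) => // /(_ isT).
by apply/funext => l; rewrite big_mkcond.
Qed.

Lemma measurable_laguerre_weight : measurable_fun setT w.
Proof.
apply: measurable_funM.
  apply: measurable_prod => i _; apply: measurable_funM.
    exact: (measurableT_comp (measurable_powR _) (measurable_tnth _)).
  apply: measurableT_comp => //.
  apply: measurableT_comp => //; apply: measurable_funM => //.
  exact: measurable_tnth.
apply: measurable_prod => j _; apply: measurable_prod_cond => k _.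
apply: (measurableT_comp (measurable_powR _)).
apply: measurableT_comp => //.
by apply: measurable_funB; exact: measurable_tnth.
Qed.

Lemma laguerre_weight_ge0 l : 0 <= w l.
Proof.
apply: mulr_ge0; first by rewrite prodr_ge0// => i _; rewrite mulr_ge0 ?powR_ge0 ?expR_ge0.
by rewrite prodr_ge0// => i _; rewrite prodr_ge0// => j _; rewrite powR_ge0.
Qed.

Definition laguerre_integral (f : N.-tuple R -> R) : \bar R :=
  orthant_integral (fun l => (f l * w l)%:E).

Let vandermonde_bounded :
  poly_bounded (fun l : N.-tuple R => \prod_(j < N) \prod_(k < N | (j < k)%N)
     `|tnth l k - tnth l j| `^ (2 * kappa)).
Proof.
apply: poly_bounded_prod => j _; apply: poly_bounded_prod => k _.
apply: poly_bounded_powR; first by rewrite mulr_ge0// ltW.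
apply: poly_boundedD; first exact: poly_bounded_tnth.
exact/poly_boundedN/poly_bounded_tnth.
Qed.

Let mfw (f : N.-tuple R -> R) : measurable_fun setT f ->
  measurable_fun setT (fun l => (f l * w l)%:E).
Proof.
move=> mf; apply/measurable_EFinP.
exact: measurable_funM mf measurable_laguerre_weight.
Qed.

Let fw0 (f : N.-tuple R -> R) : (forall l, positive_tuple l -> 0 <= f l) ->
  forall l, positive_tuple l -> (0 <= (f l * w l)%:E)%E.
Proof. by move=> f0 l l0; rewrite lee_fin mulr_ge0 ?f0 ?laguerre_weight_ge0. Qed.

(** Once the Vandermonde factor is absorbed in the polynomial bound, the majorant is a product of
    one-variable functions, each with a finite gamma integral. *)
Lemma laguerre_integral_fin (f : N.-tuple R -> R) : measurable_fun setT f ->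
  (forall l, positive_tuple l -> 0 <= f l) -> poly_bounded f ->
  laguerre_integral f \is a fin_num.
Proof.
move=> mf f0 Bf.
have [C [d [C0 H]]] := poly_boundedM Bf vandermonde_bounded.
rewrite ge0_fin_numE; last by apply: orthant_integral_ge0; exact: fw0.
pose g x : R := x `^ (kappa * a) * expR (- (kappa * x)) * (1 + x) ^+ d.
have g0 x : 0 < x -> 0 <= g x.
  by move=> x0; rewrite !mulr_ge0 ?powR_ge0 ?expR_ge0 ?exprn_ge0 ?addr_ge0 ?ltW.
have mg : measurable_fun [set: R] g.
  apply: measurable_funM; first apply: measurable_funM => //.
    apply: measurableT_comp => //.
    by apply: measurableT_comp => //; exact: measurable_funM.
  by apply: measurable_funX; exact: measurable_funD.
have mG : measurable_fun setT (fun l : N.-tuple R => (\prod_(i < N) g (tnth l i))%:E).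
  apply/measurable_EFinP; apply: measurable_prod => i _.
  exact: (measurableT_comp mg (measurable_tnth _)).
have G0 l : positive_tuple l -> (0 <= (\prod_(i < N) g (tnth l i))%:E)%E.
  by move=> l0; rewrite lee_fin prodr_ge0// => i _; exact: g0.
apply: (@le_lt_trans _ _ (orthant_integral
    (fun l : N.-tuple R => C%:E * (\prod_(i < N) g (tnth l i))%:E)%E)).
  apply: le_orthant_integral.
  - exact: mfw.
  - exact: emeasurable_funM.
  - exact: fw0.
  - move=> l l0; rewrite -EFinM lee_fin /laguerre_weight /g [in leRHS]big_split /= mulrCA.
    rewrite [leRHS]mulrCA ler_wpM2l//.
      by rewrite prodr_ge0// => i _; rewrite mulr_ge0 ?powR_ge0 ?expR_ge0.
    by rewrite prodrXl (le_trans _ (H _ l0))// ler_norm.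
rewrite (@orthant_integralZ _ _ C%:E _ mG)// (orthant_integral_prod (g := fun=> g))//.
have I0 : (0 <= \int[lebesgue_measure]_(x in `]0%R, +oo[) (g x)%:E)%E.
  by apply: integral_ge0 => x /mem_Rpos x0; rewrite lee_fin g0.
rewrite ltey_eq fin_numM//; elim/big_ind: _ => // [*|_ _]; first exact: fin_numM.
rewrite ge0_fin_numE//.
exact: gamma_integral_lty.
Qed.

Lemma laguerre_integralD (f g : N.-tuple R -> R) : measurable_fun setT f -> measurable_fun setT g ->
  (forall l, positive_tuple l -> 0 <= f l) ->
  (forall l, positive_tuple l -> 0 <= g l) ->
  laguerre_integral (fun l => f l + g l) = (laguerre_integral f + laguerre_integral g)%E.
Proof.
move=> mf mg f0 g0; rewrite /laguerre_integral.
under eq_fun do rewrite mulrDl EFinD.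
by rewrite orthant_integralD//; [exact: mfw|exact: mfw|exact: fw0|exact: fw0].
Qed.

Lemma laguerre_integralZ c (f : N.-tuple R -> R) : 0 <= c -> measurable_fun setT f ->
  (forall l, positive_tuple l -> 0 <= f l) ->
  laguerre_integral (fun l => c * f l) = (c%:E * laguerre_integral f)%E.
Proof.
move=> c0 mf f0; rewrite /laguerre_integral.
under eq_fun do rewrite -mulrA EFinM.
by rewrite orthant_integralZ//; [exact: mfw|exact: fw0].
Qed.

Lemma le_laguerre_integral (f g : N.-tuple R -> R) :
  measurable_fun setT f -> measurable_fun setT g ->
  (forall l, positive_tuple l -> 0 <= f l) ->
  (forall l, positive_tuple l -> f l <= g l) ->
  (laguerre_integral f <= laguerre_integral g)%E.
Proof.
move=> mf mg f0 fg; apply: le_orthant_integral; [exact: mfw|exact: mfw|exact: fw0|].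
by move=> l l0; rewrite lee_fin ler_wpM2r ?laguerre_weight_ge0 ?fg.
Qed.

(* On the box \prod_i [2i+1, 2i+2] the coordinates are at distance at least 1. *)
Lemma laguerre_integral1_gt0 : (0 < laguerre_integral (fun=> 1%R))%E.
Proof.
pose b := (2 * N).+2%:R : R.
(* A lower bound for the one-variable weight on 1 <= x <= b: since kappa a > -1, x^(kappa a) >= x^-1
   >= 1/b there. All sides of the box lie in this range. *)
pose c := b^-1 * expR (- (kappa * b)).
have b1 : 1 <= b by rewrite ler1n.
have b0 : 0 < b by exact: lt_le_trans b1.
have c0 : 0 < c by rewrite mulr_gt0 ?expR_gt0 ?invr_gt0.
pose I (i : 'I_N) : set R := `[(2 * i).+1%:R, (2 * i).+2%:R]%classic.
pose g i (x : R) : R := c * \1_(I i) x.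
have mg i : measurable_fun [set: R] (g i).
  by apply: measurable_funM => //; apply: measurable_indic; exact: measurable_itv.
have g0 i x : 0 <= g i x by rewrite mulr_ge0// ltW.
have Ig i : (\int[lebesgue_measure]_(x in `]0%R, +oo[) (g i x)%:E)%E = c%:E.
  under eq_integral do rewrite /g EFinM.
  rewrite ge0_integralZl_EFin ?ltW//; last first.
    by apply/measurable_EFinP; apply: measurable_indic; exact: measurable_itv.
  rewrite integral_indic//; last exact: measurable_itv.
  rewrite setIidl; last first.
    move=> x; rewrite /I /= !in_itv/= andbT => /andP[+ _].
    by apply: lt_le_trans.
  rewrite -[X in (_ * X)%E]/(lebesgue_measure (I i)) lebesgue_measure_itv /=.
  by rewrite lte_fin ltr_nat ltnSn -EFinB -natrB// subSnn mule1.
apply: (@lt_le_trans _ _ (orthant_integral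
    (fun l : N.-tuple R => (\prod_(i < N) g i (tnth l i))%:E))).
  rewrite orthant_integral_prod; [|exact: mg|by move=> i x _].
  under eq_bigr do rewrite Ig.
  by elim/big_ind: _ => [|x y x0 y0|i _]; rewrite ?lte_fin//; exact: mule_gt0.
apply: le_orthant_integral.
- apply/measurable_EFinP; apply: measurable_prod => i _.
  exact: (measurableT_comp (mg i) (measurable_tnth _)).
- by apply: mfw; exact: measurable_cst.
- by move=> l l0; rewrite lee_fin prodr_ge0.
move=> l l0; rewrite mul1r lee_fin.
have [/forallP inI|/forallPn[i]] := boolP [forall i, `[< I i (tnth l i) >]]; last first.
  move=> /asboolPn nI; rewrite (bigD1 i)//= {1}/g indicE memNset//.
  by rewrite mulr0 mul0r laguerre_weight_ge0.
have {}inI (i : 'I_N) : (2 * i).+1%:R <= tnth l i <= (2 * i).+2%:R.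
  by move: (inI i) => /asboolP; rewrite /I /= in_itv.
rewrite -[leLHS]mulr1; apply: ler_pM; rewrite ?prodr_ge0//.
  apply: ler_prod => i _; rewrite g0 /=; have /andP[li1 li2] := inI i.
  have l1 : 1 <= tnth l i by rewrite (le_trans _ li1)// ler1n.
  have lb : tnth l i <= b.
    by rewrite (le_trans li2)// ler_nat !ltnS leq_mul2l ltnW.
  apply: (@le_trans _ _ c).
    by rewrite /g indicE; case: (_ \in _); rewrite ?mulr1 ?mulr0// ltW.
  apply: ler_pM; rewrite ?expR_ge0 ?invr_ge0 ?(ltW b0)//.
    apply: (@le_trans _ _ (tnth l i `^ (-1))).
      by rewrite powR_inv1 ?lef_pV2 ?posrE// ltW.
    by apply: ler_powR => //; exact: ltW.
  by rewrite ler_expR lerN2 ler_pM2l.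
elim/big_ind: _ => // [*|j _]; first exact: mulr_ege1.
elim/big_ind: _ => // [*|k jk]; first exact: mulr_ege1.
apply: (@le_trans _ _ (1 `^ (2 * kappa))); first by rewrite powR1.
have H : 1 <= tnth l k - tnth l j.
  have /andP[_ lj] := inI j; have /andP[lk _] := inI k.
  have : (2 * j).+3%:R <= (2 * k).+1%:R :> R.
    by rewrite ler_nat !ltnS -addn2 -mulnSr leq_mul2l.
  by rewrite -natr1 => H; move: H lj lk; lra.
apply: ge0_ler_powR; rewrite ?nnegrE//.
  by rewrite mulr_ge0// ltW.
by rewrite (le_trans H)// ler_norm.
Qed.

End weight.

(** * First-order expansions with polynomially bounded errors *)

Section first_order.
Context {R : realType} {N : nat}.
Implicit Types (f g h D : N.-tuple R -> R) (H : R -> N.-tuple R -> R).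

(** A one-sided Taylor expansion at t = 0. The error is uniform in t and has a polynomially bounded
    coefficient, so that it can be integrated against the weight. *)
Definition first_order H h D := [/\ poly_bounded h, poly_bounded D &
  exists2 E, poly_bounded E & forall t l, 0 <= t <= 1 -> positive_tuple l ->
    `|H t l - h l - t * D l| <= t ^+ 2 * E l].

Lemma first_order_eq H h D H' h' D' : first_order H h D ->
  (forall t l, 0 <= t <= 1 -> positive_tuple l -> H t l = H' t l) ->
  (forall l, positive_tuple l -> h l = h' l) ->
  (forall l, positive_tuple l -> D l = D' l) -> first_order H' h' D'.
Proof.
move=> [ph pD [E pE HE]] eH eh eD; split.
- by apply: (poly_bounded_le ph) => l l0; rewrite eh.
- by apply: (poly_bounded_le pD) => l l0; rewrite eD.
- by exists E => // t l t01 l0; rewrite -eH// -eh// -eD// HE.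
Qed.

Lemma first_order_affine h D : poly_bounded h -> poly_bounded D ->
  first_order (fun t l => h l + t * D l) h D.
Proof.
move=> ph pD; split=> //; exists (fun=> 0); first exact: poly_bounded_cst.
by move=> t l _ _; rewrite (_ : _ - _ = 0) ?normr0 ?mulr0//; ring.
Qed.

Lemma first_order_cst h : poly_bounded h -> first_order (fun=> h) h (fun=> 0).
Proof.
move=> ph; apply: first_order_eq (first_order_affine ph (poly_bounded_cst 0)) _ _ _ => //.
by move=> t l _ _; rewrite mulr0 addr0.
Qed.

Lemma first_orderD H h D H' h' D' : first_order H h D -> first_order H' h' D' ->
  first_order (fun t l => H t l + H' t l) (fun l => h l + h' l) (fun l => D l + D' l).
Proof.
move=> [ph pD [E pE HE]] [ph' pD' [E' pE' HE']]; split; try exact: poly_boundedD.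
exists (fun l => E l + E' l); first exact: poly_boundedD.
move=> t l t01 l0.
rewrite (_ : _ - _ = (H t l - h l - t * D l) + (H' t l - h' l - t * D' l)); last by ring.
by rewrite mulrDr (le_trans (ler_normD _ _))// lerD ?HE ?HE'.
Qed.

Lemma first_orderM H h D H' h' D' : first_order H h D -> first_order H' h' D' ->
  first_order (fun t l => H t l * H' t l) (fun l => h l * h' l)
    (fun l => D l * h' l + h l * D' l).
Proof.
move=> [ph pD [E pE HE]] [ph' pD' [E' pE' HE']]; split.
- exact: poly_boundedM.
- by apply: poly_boundedD; exact: poly_boundedM.
exists (fun l => `|D l| * `|D' l| + `|h l| * `|E' l| + `|E l| * `|h' l| +
  `|D l| * `|E' l| + `|E l| * `|D' l| + `|E l| * `|E' l|).
  by do 5?[apply: poly_boundedD]; apply: poly_boundedM; exact: poly_bounded_norm.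
move=> t l t01 l0; have /andP[t0 t1] := t01.
pose e := H t l - h l - t * D l; pose e' := H' t l - h' l - t * D' l.
have le_e : `|e| <= t ^+ 2 * `|E l|.
  by rewrite (le_trans (HE _ _ t01 l0))// ler_wpM2l ?exprn_ge0 ?ler_norm.
have le_e' : `|e'| <= t ^+ 2 * `|E' l|.
  by rewrite (le_trans (HE' _ _ t01 l0))// ler_wpM2l ?exprn_ge0 ?ler_norm.
(* What remains of (h + t D + e)(h' + t D' + e') beyond first order. Terms carrying t^3 or t^4 are
   reduced to t^2 by t <= 1. *)
rewrite (_ : _ - _ = t * D l * (t * D' l) + h l * e' + e * h' l +
    t * D l * e' + e * (t * D' l) + e * e'); last by rewrite /e /e'; ring.
have t2 : t ^+ 2 <= 1 by rewrite exprn_ile1.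
have tX x : 0 <= x -> t * (t ^+ 2 * x) <= t ^+ 2 * x.
  by move=> x0; rewrite ler_piMl// mulr_ge0 ?exprn_ge0.
clearbody e e'. rewrite !mulrDr.
do 5?[apply: (le_trans (ler_normD _ _)); apply: lerD]; rewrite !normrM ?(ger0_norm t0).
- by rewrite mulrACA -expr2.
- by rewrite mulrCA ler_wpM2l.
- by rewrite mulrA ler_wpM2r.
- apply: (le_trans (ler_wpM2l _ le_e')); first by rewrite mulr_ge0.
  by rewrite -mulrA (mulrCA `|D l|) tX// mulr_ge0.
- apply: (le_trans (ler_wpM2r _ le_e)); first by rewrite mulr_ge0.
  by rewrite mulrCA -(mulrA (t ^+ 2)) tX// mulr_ge0.
- apply: (le_trans (ler_pM _ _ le_e le_e')) => //.
  rewrite mulrACA -mulrA ler_wpM2l ?exprn_ge0//.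
  by rewrite ler_piMl// mulr_ge0.
Qed.

Lemma first_orderX H h D n : first_order H h D ->
  first_order (fun t l => H t l ^+ n) (fun l => h l ^+ n)
    (fun l => n%:R * h l ^+ n.-1 * D l).
Proof.
move=> HD; elim: n => [|n IH].
  by apply: (first_order_eq (first_order_cst (poly_bounded_cst 1))) => // *; rewrite !mul0r.
apply: (first_order_eq (first_orderM HD IH)) => [t l _ _|l _|l _]; rewrite ?exprS//=.
case: n {IH} => [|n]; first by rewrite /= expr0; ring.
by rewrite /= exprS -[in RHS]natr1; ring.
Qed.

Lemma first_order_sum (I : Type) (r : seq I) (P : pred I) (H : I -> R -> N.-tuple R -> R)
    (h D : I -> N.-tuple R -> R) : (forall i, P i -> first_order (H i) (h i) (D i)) ->
  first_order (fun t l => \sum_(i <- r | P i) H i t l)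
    (fun l => \sum_(i <- r | P i) h i l) (fun l => \sum_(i <- r | P i) D i l).
Proof.
move=> HD; elim: r => [|i r IH].
  by apply: (first_order_eq (first_order_cst (poly_bounded_cst 0))) => // *; rewrite big_nil.
have [Pi|nPi] := boolP (P i); last first.
  by apply: (first_order_eq IH) => // *; rewrite big_cons (negbTE nPi).
by apply: (first_order_eq (first_orderD (HD _ Pi) IH)) => // *; rewrite big_cons Pi.
Qed.

Lemma first_order_prod1 (I : Type) (r : seq I) (P : pred I) (H : I -> R -> N.-tuple R -> R)
    (D : I -> N.-tuple R -> R) : (forall i, P i -> first_order (H i) (fun=> 1) (D i)) ->
  first_order (fun t l => \prod_(i <- r | P i) H i t l)
    (fun=> 1) (fun l => \sum_(i <- r | P i) D i l).
Proof.
move=> HD; elim: r => [|i r IH].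
  by apply: (first_order_eq (first_order_cst (poly_bounded_cst 1))) => // *; rewrite big_nil.
have [Pi|nPi] := boolP (P i); last first.
  by apply: (first_order_eq IH) => // *; rewrite big_cons (negbTE nPi).
by apply: (first_order_eq (first_orderM (HD _ Pi) IH)) => // *;
  rewrite ?big_cons ?Pi ?mulr1 ?mul1r.
Qed.

(** From e^r (1 - r) <= 1 one gets e^r - 1 - r <= r (e^r - 1). The right side is at most r^2 e^r for
    r >= 0 and at most r^2 for r < 0. *)
Lemma expR_second_order (r : R) : `|expR r - 1 - r| <= r ^+ 2 * (1 + expR r).
Proof.
have e0 := expR_gt0 r.
rewrite ger0_norm; last by have := expR_ge1Dx r; lra.
have H : expR r * (1 - r) <= 1.
  have := expR_ge1Dx (- r); rewrite expRN => Hr.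
  by rewrite mulrC -ler_pdivlMr// div1r.
have [r0|r0] := leP 0 r.
  have : r * (expR r - 1) <= r * (r * expR r) by rewrite ler_wpM2l//; lra.
  by have := sqr_ge0 r; rewrite expr2; lra.
have : - r * (1 - expR r) <= - r * (- r).
  apply: ler_wpM2l; first by rewrite oppr_ge0 ltW.
  by have := expR_ge1Dx r; lra.
have : 0 <= r ^+ 2 * expR r by rewrite mulr_ge0 ?sqr_ge0// ltW.
by rewrite expr2; lra.
Qed.

(** The exponential of a polynomially bounded function need not be polynomially bounded, so a bound
    [M] on the exponential itself has to be supplied. *)
Lemma first_order_expR H D M : first_order H (fun=> 0) D -> poly_bounded M ->
  (forall t l, 0 <= t <= 1 -> positive_tuple l -> expR (H t l) <= M l) ->
  first_order (fun t l => expR (H t l)) (fun=> 1) D.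
Proof.
move=> [_ pD [E pE HE]] pM HM; split=> //; first exact: poly_bounded_cst.
exists (fun l => (`|D l| + `|E l|) ^+ 2 * (1 + M l) + `|E l|).
  apply: poly_boundedD; last exact: poly_bounded_norm.
  apply: poly_boundedM; last by apply: poly_boundedD => //; exact: poly_bounded_cst.
  by apply: poly_boundedX; apply: poly_boundedD; exact: poly_bounded_norm.
move=> t l t01 l0; have /andP[t0 t1] := t01.
have {HE}le_e : `|H t l - t * D l| <= t ^+ 2 * `|E l|.
  rewrite -[H t l]subr0 (le_trans (HE _ _ t01 l0))// ler_wpM2l ?exprn_ge0 ?ler_norm//.
have Hr : `|H t l| <= t * (`|D l| + `|E l|).
  rewrite -[H t l](subrK (t * D l)) (le_trans (ler_normD _ _))// addrC mulrDr lerD//.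
    by rewrite normrM (ger0_norm t0).
  rewrite (le_trans le_e)// ler_wpM2r// expr2 ler_piMl//.
rewrite (_ : _ - _ = (expR (H t l) - 1 - H t l) + (H t l - t * D l)); last by ring.
rewrite (le_trans (ler_normD _ _))// mulrDr lerD//.
apply: (le_trans (expR_second_order _)).
rewrite mulrA -exprMn; apply: ler_pM; rewrite ?sqr_ge0 ?addr_ge0 ?expR_ge0//.
  by rewrite -real_normK ?num_real// lerXn2r ?nnegrE// mulr_ge0 ?addr_ge0.
by rewrite lerD2l HM.
Qed.

Lemma first_order_expRN q : poly_bounded q ->
  (forall l, positive_tuple l -> 0 <= q l) ->
  first_order (fun t l => expR (- (t * q l))) (fun=> 1) (fun l => - q l).
Proof.
move=> pq q0; apply: (@first_order_expR _ _ (fun=> 1)).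
- apply: (first_order_eq (first_order_affine (poly_bounded_cst 0) (poly_boundedN pq))) => //.
  by move=> t l _ _; rewrite add0r mulrN.
- exact: poly_bounded_cst.
- move=> t l /andP[t0 _] l0; rewrite -[leRHS]expR0 ler_expR oppr_le0.
  by rewrite mulr_ge0 ?q0.
Qed.

Lemma ln1D_second_order (s : R) : 0 <= s -> `|ln (1 + s) - s| <= s ^+ 2.
Proof.
move=> s0; have s1 : 0 < 1 + s by lra.
have H1 : ln (1 + s) <= s.
  by rewrite -ler_expR lnK ?posrE// expR_ge1Dx.
have H2 : s - s ^+ 2 <= ln (1 + s).
  apply: (@le_trans _ _ (s / (1 + s))).
    by rewrite ler_pdivlMr//; have : 0 <= s ^+ 3 by [rewrite exprn_ge0]; rewrite exprS; lra.
  have := expR_ge1Dx (- ln (1 + s)).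
  rewrite expRN lnK ?posrE// (_ : s / (1 + s) = 1 - (1 + s)^-1); first by lra.
  by field; rewrite gt_eqF.
by rewrite ler0_norm ?subr_le0//; lra.
Qed.

(** The power is the exponential of c ln(1 + t q). As the base is at least 1, it is at most (1 +
    q)^|c| whatever the sign of c, which provides the bound [M]. *)
Lemma first_order_powR c q : poly_bounded q ->
  (forall l, positive_tuple l -> 0 <= q l) ->
  first_order (fun t l => (1 + t * q l) `^ c) (fun=> 1) (fun l => c * q l).
Proof.
move=> pq q0.
have tq0 t l : 0 <= t <= 1 -> positive_tuple l -> 0 <= t * q l.
  by move=> /andP[t0 _] l0; rewrite mulr_ge0 ?q0.
have pow t l : 0 <= t <= 1 -> positive_tuple l ->
    expR (c * ln (1 + t * q l)) = (1 + t * q l) `^ c.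
  move=> t01 l0; rewrite /powR gt_eqF//.
  by have := tq0 _ _ t01 l0; lra.
have HM : poly_bounded (fun l => `|1 + q l| `^ `|c|).
  by apply: poly_bounded_powR => //; apply: poly_boundedD => //; exact: poly_bounded_cst.
apply: (@first_order_eq (fun t l => expR (c * ln (1 + t * q l))) (fun=> 1)
  (fun l => c * q l)) => //.
apply: (first_order_expR _ HM).
  split; first exact: poly_bounded_cst.
    by apply: poly_boundedM => //; exact: poly_bounded_cst.
  exists (fun l => `|c| * q l ^+ 2).
    by apply: poly_boundedM; [exact: poly_bounded_cst|exact: poly_boundedX].
  move=> t l t01 l0; rewrite subr0 mulrCA -mulrBr normrM mulrCA ler_wpM2l//.
  by rewrite -exprMn ln1D_second_order// tq0.
move=> t l t01 l0; rewrite pow//.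
have H1 := tq0 _ _ t01 l0.
apply: (@le_trans _ _ ((1 + t * q l) `^ `|c|)).
  by apply: ler_powR; rewrite ?ler_norm// lerDl.
rewrite [`|1 + _|]ger0_norm; last by rewrite addr_ge0 ?q0.
apply: ge0_ler_powR; rewrite ?nnegrE ?addr_ge0 ?q0//.
by rewrite lerD2l ler_piMl ?q0//; case/andP: t01.
Qed.

End first_order.

(** * Stationary integrals *)

Section admissible.
Context {R : realType} {N : nat}.
Implicit Types (f g : N.-tuple R -> R).

Definition admissible f := [/\ measurable_fun setT f,
  forall l, positive_tuple l -> 0 <= f l & poly_bounded f].

Lemma admissible_cst c : 0 <= c -> admissible (fun=> c).
Proof. by move=> c0; split=> //; exact: poly_bounded_cst. Qed.

Lemma admissible_tnth i : admissible (fun l => tnth l i).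
Proof.
split; [exact: measurable_tnth|by move=> l l0; exact: ltW|exact: poly_bounded_tnth].
Qed.

Lemma admissibleD f g : admissible f -> admissible g -> admissible (fun l => f l + g l).
Proof.
move=> [mf f0 pf] [mg g0 pg]; split; [exact: measurable_funD| |exact: poly_boundedD].
by move=> l l0; rewrite addr_ge0 ?f0 ?g0.
Qed.

Lemma admissibleM f g : admissible f -> admissible g -> admissible (fun l => f l * g l).
Proof.
move=> [mf f0 pf] [mg g0 pg]; split; [exact: measurable_funM| |exact: poly_boundedM].
by move=> l l0; rewrite mulr_ge0 ?f0 ?g0.
Qed.

Lemma admissibleZ c f : 0 <= c -> admissible f -> admissible (fun l => c * f l).
Proof. by move=> c0; apply: admissibleM; exact: admissible_cst. Qed.

Lemma admissibleX f n : admissible f -> admissible (fun l => f l ^+ n).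
Proof.
move=> Af; elim: n => [|n IH]; first by under eq_fun do rewrite expr0; exact: admissible_cst.
by under eq_fun do rewrite exprS; exact: admissibleM.
Qed.

Lemma admissible_sum (I : Type) (r : seq I) (F : I -> N.-tuple R -> R) :
  (forall i, admissible (F i)) -> admissible (fun l => \sum_(i <- r) F i l).
Proof.
move=> H; elim: r => [|i r IH].
  by under eq_fun do rewrite big_nil; exact: admissible_cst.
by under eq_fun do rewrite big_cons; exact: admissibleD.
Qed.

Lemma admissible_prod (I : Type) (r : seq I) (F : I -> N.-tuple R -> R) :
  (forall i, admissible (F i)) -> admissible (fun l => \prod_(i <- r) F i l).
Proof.
move=> H; elim: r => [|i r IH].
  by under eq_fun do rewrite big_nil; exact: admissible_cst.
by under eq_fun do rewrite big_cons; exact: admissibleM.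
Qed.

(** The error coefficient in [first_order] carries no measurability; this gives it a majorant that
    can be integrated. *)
Lemma poly_bounded_admissible f : poly_bounded f ->
  exists2 g, admissible g & forall l, positive_tuple l -> `|f l| <= g l.
Proof.
move=> [C [d [C0 H]]]; exists (fun l => C * growth l ^+ d) => //.
apply: admissibleZ => //; apply: admissibleX; apply: admissible_prod => i.
by apply: admissibleD; [exact: admissible_cst|exact: admissible_tnth].
Qed.

Lemma first_order_admissible (H : R -> N.-tuple R -> R) h D t : first_order H h D ->
  0 <= t <= 1 -> measurable_fun setT (H t) ->
  (forall l, positive_tuple l -> 0 <= H t l) -> admissible (H t).
Proof.
move=> [ph pD [E pE HE]] t01 mH H0; split=> //.
apply: (poly_bounded_le (poly_boundedD (poly_bounded_norm ph)
  (poly_boundedD (poly_bounded_norm (poly_boundedM (poly_bounded_cst t) pD))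
    (poly_bounded_norm (poly_boundedM (poly_bounded_cst (t ^+ 2)) pE))))) => l l0.
rewrite [leRHS]ger0_norm ?addr_ge0//.
rewrite -[H t l](subrK (h l)) -[_ - _](subrK (t * D l)).
rewrite addrC (le_trans (ler_normD _ _))// lerD// addrC.
by rewrite (le_trans (ler_normD _ _))// lerD// (le_trans (HE _ _ t01 l0)) ?ler_norm.
Qed.

Variables (kappa a : R).
Hypotheses (kappa0 : 0 < kappa) (a1 : -1 < kappa * a).

Definition laguerre_rintegral f : R := fine (laguerre_integral kappa a f).
Local Notation J := laguerre_rintegral.

Lemma laguerre_rintegralK f : admissible f ->
  (J f)%:E = laguerre_integral kappa a f.
Proof. by move=> [mf f0 pf]; rewrite fineK// laguerre_integral_fin. Qed.

Lemma laguerre_rintegralD f g : admissible f -> admissible g ->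
  J (fun l => f l + g l) = J f + J g.
Proof.
move=> Af Ag; have [mf f0 pf] := Af; have [mg g0 pg] := Ag.
by rewrite /J laguerre_integralD// fineD// laguerre_integral_fin.
Qed.

Lemma laguerre_rintegralZ c f : 0 <= c -> admissible f ->
  J (fun l => c * f l) = c * J f.
Proof.
move=> c0 Af; have [mf f0 pf] := Af.
by rewrite /J laguerre_integralZ// fineM// laguerre_integral_fin.
Qed.

Lemma laguerre_rintegral_sum (I : Type) (r : seq I) (F : I -> N.-tuple R -> R) :
  (forall i, admissible (F i)) ->
  J (fun l => \sum_(i <- r) F i l) = \sum_(i <- r) J (F i).
Proof.
move=> H; elim: r => [|i r IH].
  rewrite big_nil; under [X in J X]eq_fun do rewrite big_nil -(mul0r 1).
  by rewrite laguerre_rintegralZ ?mul0r//; exact: admissible_cst.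
rewrite big_cons -IH -laguerre_rintegralD//; last exact: admissible_sum.
by congr J; apply/funext => l; rewrite big_cons.
Qed.

Lemma le_laguerre_rintegral f g : admissible f -> admissible g ->
  (forall l, positive_tuple l -> f l <= g l) -> J f <= J g.
Proof.
move=> Af Ag fg; rewrite -lee_fin !laguerre_rintegralK//.
by have [mf f0 pf] := Af; have [mg g0 pg] := Ag; exact: le_laguerre_integral.
Qed.

Lemma laguerre_rintegral1_gt0 : 0 < J (fun=> 1).
Proof.
by rewrite -lte_fin laguerre_rintegralK ?laguerre_integral1_gt0//; exact: admissible_cst.
Qed.

Lemma le_of_le_addM (x y z : R) : (forall t, 0 < t <= 1 -> x <= y + t * z) -> x <= y.
Proof.
move=> H; apply/ler_addgt0Pr => e e0; pose t := Num.min 1 (e / (1 + `|z|)).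
have z1 : 0 < 1 + `|z| by rewrite ltr_pwDl.
have t0 : 0 < t by rewrite lt_min ltr01 divr_gt0.
apply: (le_trans (H t _)); first by rewrite t0 ge_min lexx.
rewrite lerD2l (@le_trans _ _ (t * (1 + `|z|)))//.
  by rewrite ler_pM2l// (le_trans (ler_norm _))// lerDr.
by rewrite -ler_pdivlMr// ge_min lexx orbT.
Qed.

(** A constant function of t has zero derivative at 0+. The first-order term is split as B - A
    because additivity of the integral is available for nonnegative functions. *)
Lemma stationary_laguerre_rintegral (H : R -> N.-tuple R -> R) h A B :
  first_order H h (fun l => B l - A l) ->
  admissible h -> admissible A -> admissible B ->
  (forall t, measurable_fun setT (H t)) ->
  (forall t l, 0 <= t <= 1 -> positive_tuple l -> 0 <= H t l) ->
  (forall t, 0 <= t <= 1 -> J (H t) = J h) -> J A = J B.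
Proof.
move=> FO Ah AA AB mH H0 HJ; have [_ _ [E pE HE]] := FO.
have [G AG EG] := poly_bounded_admissible pE.
have {}HE t l : 0 <= t <= 1 -> positive_tuple l ->
    `|H t l - h l - t * (B l - A l)| <= t ^+ 2 * G l.
  move=> t01 l0; rewrite (le_trans (HE _ _ t01 l0))// ler_wpM2l ?sqr_ge0//.
  exact: le_trans (ler_norm _) (EG _ l0).
have AH t : 0 <= t <= 1 -> admissible (H t).
  by move=> t01; apply: (first_order_admissible FO) => // l; exact: H0.
(* One inequality serves both directions: it is used with ([H t], [h]) for J A <= J B and with the
   two exchanged for the converse. The equal integrals of h' and h'' cancel before dividing by t. *)
have key t A' B' : 0 < t <= 1 -> admissible A' -> admissible B' ->
    forall h' h'', admissible h' -> admissible h'' -> J h' = J h'' ->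
    (forall l, positive_tuple l -> h' l + t * A' l <= h'' l + t * B' l + t ^+ 2 * G l) ->
    J A' <= J B' + t * J G.
  move=> /andP[t0 t1] AA' AB' h' h'' Ah' Ah'' hh' le.
  have tt := ltW t0.
  have : J (fun l => h' l + t * A' l) <= J (fun l => (h'' l + t * B' l) + t ^+ 2 * G l).
    apply: le_laguerre_rintegral => //; first by apply: admissibleD => //; exact: admissibleZ.
    by do 2?[apply: admissibleD => //]; apply: admissibleZ => //; exact: sqr_ge0.
  rewrite laguerre_rintegralD ?laguerre_rintegralZ//; last exact: admissibleZ.
  rewrite laguerre_rintegralD ?laguerre_rintegralZ ?sqr_ge0//; last 2 first.
  - by apply: admissibleD => //; exact: admissibleZ.
  - by apply: admissibleZ => //; exact: sqr_ge0.
  rewrite laguerre_rintegralD ?laguerre_rintegralZ//; last exact: admissibleZ.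
  by rewrite hh' -addrA lerD2l expr2 -mulrA -mulrDr ler_pM2l.
apply/eqP; rewrite eq_le; apply/andP; split; apply: (@le_of_le_addM _ _ (J G)) => t t01;
  have t01' : 0 <= t <= 1 by case/andP: t01 => /ltW -> ->.
- apply: (key t A B t01 AA AB (H t) h (AH _ t01') Ah (HJ _ t01')) => l l0.
  by have := HE _ _ t01' l0; rewrite ler_norml => /andP[]; lra.
- apply: (key t B A t01 AB AA h (H t) Ah (AH _ t01') (esym (HJ _ t01'))) => l l0.
  by have := HE _ _ t01' l0; rewrite ler_norml => /andP[]; lra.
Qed.

End admissible.

(** * Loop equations *)

Section loop_equation.
Context {R : realType} {N : nat}.
Implicit Types (l : N.-tuple R) (s : seq nat).

Definition power_sum l p : R := \sum_(j < N) tnth l j ^+ p.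

Definition power_sums s l : R := \prod_(p <- s) power_sum l p.

(* The terms (p_i, [:: p_1; ...; p_i + k; ...; p_n]) of the derivative of
   [power_sums s] along sum_j x_j^(k+1) d/dx_j. *)
Fixpoint raise_terms k s : seq (nat * seq nat) :=
  if s is p :: s' then
    (p, (p + k)%N :: s') :: [seq (x.1, p :: x.2) | x <- raise_terms k s']
  else [::].

Lemma admissible_power_sum p : admissible (fun l => power_sum l p).
Proof. by apply: admissible_sum => i; apply: admissibleX; exact: admissible_tnth. Qed.

Lemma admissible_power_sums s : admissible (power_sums s).
Proof. by apply: admissible_prod => p; exact: admissible_power_sum. Qed.

Lemma power_sums_cons p s l : power_sums (p :: s) l = power_sum l p * power_sums s l.
Proof. by rewrite /power_sums big_cons. Qed.

Let raised k t x : R := x + t * x ^+ k.+1.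

Let first_order_raised_sum k p :
  first_order (fun t l => \sum_(j < N) raised k t (tnth l j) ^+ p)
    (fun l => power_sum l p) (fun l => p%:R * power_sum l (p + k)).
Proof.
have H (j : 'I_N) := first_order_affine (poly_bounded_tnth j)
  (poly_boundedX k.+1 (@poly_bounded_tnth R _ j)).
apply: (first_order_eq (first_order_sum (index_enum 'I_N) (P := xpredT)
  (fun j _ => first_orderX p (H j)))) => // l l0.
rewrite /power_sum mulr_sumr; apply: eq_bigr => j _.
case: p => [|p]; first by rewrite !mul0r.
by rewrite -mulrA -exprD addSnnS addnS.
Qed.

Let first_order_raised_sums k s :
  first_order (fun t l => \prod_(p <- s) \sum_(j < N) raised k t (tnth l j) ^+ p)
    (power_sums s) (fun l => \sum_(x <- raise_terms k s) x.1%:R * power_sums x.2 l).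
Proof.
elim: s => [|p s IH].
  apply: (first_order_eq (first_order_cst (poly_bounded_cst 1))) => [t|l|l] *;
  by rewrite /power_sums ?big_nil.
apply: (first_order_eq (first_orderM (first_order_raised_sum k p) IH))
  => [t l _ _|l _|l _ /=]; rewrite ?power_sums_cons ?big_cons//=.
rewrite power_sums_cons mulrA big_map; congr (_ + _).
by rewrite mulr_sumr; apply: eq_bigr => x _ /=; rewrite power_sums_cons mulrCA.
Qed.

(** The complete homogeneous symmetric polynomial of degree k in two variables, that is (x^(k+1) -
    y^(k+1)) / (x - y) off the diagonal. *)
Definition complete_sum k (x y : R) : R := \sum_(m < k.+1) x ^+ (k - m) * y ^+ m.

Lemma complete_sum_ge0 k x y : 0 <= x -> 0 <= y -> 0 <= complete_sum k x y.
Proof. by move=> x0 y0; apply: sumr_ge0 => m _; rewrite mulr_ge0 ?exprn_ge0. Qed.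

Lemma complete_sumC k x y : complete_sum k x y = complete_sum k y x.
Proof.
rewrite /complete_sum (reindex_inj rev_ord_inj) /=; apply: eq_bigr => m _.
by rewrite mulrC subSS subKn// -ltnS.
Qed.

Lemma complete_sumxx k x : complete_sum k x x = k.+1%:R * x ^+ k.
Proof.
rewrite /complete_sum (eq_bigr (fun=> x ^+ k)) ?sumr_const ?card_ord ?mulr_natl// => m _.
by rewrite -exprD subnK// -ltnS.
Qed.

Let raisedB k t x y :
  raised k t x - raised k t y = (x - y) * (1 + t * complete_sum k x y).
Proof.
rewrite /raised mulrDr mulr1 mulrCA -(subrXX x y k.+1).
by ring.
Qed.

Lemma sum_sym_pairs (f : 'I_N -> 'I_N -> R) : (forall i j, f i j = f j i) ->
  \sum_i \sum_j f i j =
  2 * (\sum_(i < N) \sum_(j < N | (i < j)%N) f i j) + \sum_i f i i.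
Proof.
move=> fC.
have -> : \sum_i \sum_j f i j = \sum_(i < N) (\sum_(j < N | (i < j)%N) f i j
    + \sum_(j < N | (j < i)%N) f i j + f i i).
  apply: eq_bigr => i _; rewrite (bigD1 i)//= addrC; congr (_ + _).
  rewrite (bigID (fun j : 'I_N => (i < j)%N))/=; congr (_ + _); apply: eq_bigl => j.
    by rewrite -val_eqE /=; case: ltngtP.
  by rewrite -val_eqE /=; case: ltngtP.
rewrite !big_split /= mulr_natl mulr2n; congr (_ + _ + _).
rewrite (exchange_big_dep xpredT)//=; apply: eq_bigr => i _.
by apply: eq_bigr.
Qed.

(** The double sum over all ordered pairs factorises into products of power sums. Removing its
    diagonal costs (k+1) p_k, the origin of the term -kappa (k+1) in the loop equation. *)
Lemma sum_complete_sum k l :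
  2 * (\sum_(j < N) \sum_(i < N | (j < i)%N) complete_sum k (tnth l i) (tnth l j)) =
  \sum_(m < k.+1) power_sum l m * power_sum l (k - m) - k.+1%:R * power_sum l k.
Proof.
have H := @sum_sym_pairs (fun j i => complete_sum k (tnth l i) (tnth l j))
  (fun i j => complete_sumC _ _ _).
have -> : k.+1%:R * power_sum l k = \sum_i complete_sum k (tnth l i) (tnth l i).
  by rewrite /power_sum mulr_sumr; apply: eq_bigr => i _; rewrite complete_sumxx.
apply: (addIr (\sum_i complete_sum k (tnth l i) (tnth l i))); rewrite subrK -H.
rewrite /complete_sum.
under eq_bigr do rewrite exchange_big /=.
rewrite exchange_big /=; apply: eq_bigr => m _.
rewrite /power_sum mulr_suml; apply: eq_bigr => j _; rewrite mulr_sumr.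
by apply: eq_bigr => i _; rewrite mulrC.
Qed.

Variables (kappa a : R).
Hypotheses (kappa0 : 0 < kappa) (a1 : -1 < kappa * a).
Local Notation w := (@laguerre_weight R N kappa a).
Local Notation J := (laguerre_rintegral kappa a).

(* Jacobian of the change of variables times the ratio of the weights. *)
Let weight_ratio k t l :=
  (\prod_(j < N) ((1 + t * tnth l j ^+ k) `^ (kappa * a) *
    expR (- (t * (kappa * tnth l j ^+ k.+1))) * (1 + t * (k.+1%:R * tnth l j ^+ k)))) *
  \prod_(j < N) \prod_(i < N | (j < i)%N)
    (1 + t * complete_sum k (tnth l i) (tnth l j)) `^ (2 * kappa).

(** Each factor of the transformed weight splits off the original one: x + t x^(k+1) = x (1 + t x^k)
    for the powers, [raisedB] for the differences. Positivity of the factors makes real powers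
    multiplicative. *)
Let weight_ratioE k t l : 0 <= t -> positive_tuple l ->
  (\prod_(j < N) (1 + t * (k.+1%:R * tnth l j ^+ k))) * w [tuple of map (raised k t) l] =
  weight_ratio k t l * w l.
Proof.
move=> t0 l0; rewrite /laguerre_weight /weight_ratio [LHS]mulrA -[in LHS]big_split /=.
rewrite [RHS]mulrACA; congr (_ * _); rewrite -big_split /=; apply: eq_bigr => j _.
  have x0 := ltW (l0 j); have y0 : 0 <= 1 + t * tnth l j ^+ k.
    by rewrite addr_ge0// mulr_ge0// exprn_ge0.
  have E : raised k t (tnth l j) = (1 + t * tnth l j ^+ k) * tnth l j.
    by rewrite /raised exprS; ring.
  rewrite tnth_map [in X in X `^ _]E powRM//.
  have -> : - (kappa * raised k t (tnth l j)) =
      - (t * (kappa * tnth l j ^+ k.+1)) + - (kappa * tnth l j).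
    by rewrite /raised; ring.
  by rewrite expRD; ring.
rewrite -big_split; apply: eq_bigr => i _; rewrite !tnth_map raisedB normrM.
have c0 : 0 <= 1 + t * complete_sum k (tnth l i) (tnth l j).
  by rewrite addr_ge0// mulr_ge0// complete_sum_ge0// ltW.
by rewrite powRM// (ger0_norm c0) mulrC.
Qed.

Let first_order_weight_ratio k :
  first_order (weight_ratio k) (fun=> 1)
    (fun l => kappa * a * power_sum l k - kappa * power_sum l k.+1 + k.+1%:R * power_sum l k
      + kappa * (\sum_(m < k.+1) power_sum l m * power_sum l (k - m)
                 - k.+1%:R * power_sum l k)).
Proof.
have px j n : poly_bounded (fun l => tnth l j ^+ n).
  by apply: poly_boundedX; exact: poly_bounded_tnth.
have x0 l (j : 'I_N) n : positive_tuple l -> 0 <= tnth l j ^+ n.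
  by move=> l0; rewrite exprn_ge0// ltW.
have H1 (j : 'I_N) : first_order (fun t l => (1 + t * tnth l j ^+ k) `^ (kappa * a) *
    expR (- (t * (kappa * tnth l j ^+ k.+1))) * (1 + t * (k.+1%:R * tnth l j ^+ k)))
    (fun=> 1) (fun l => kappa * a * tnth l j ^+ k - kappa * tnth l j ^+ k.+1
      + k.+1%:R * tnth l j ^+ k).
  apply: (first_order_eq (first_orderM (first_orderM
    (first_order_powR (kappa * a) (px j k) (fun l => x0 l j k))
    (@first_order_expRN _ _ (fun l => kappa * tnth l j ^+ k.+1) _ _))
    (@first_order_affine _ _ (fun=> 1) (fun l => k.+1%:R * tnth l j ^+ k) _ _))) => //.
  - by apply: poly_boundedM => //; exact: poly_bounded_cst.
  - by move=> l l0; rewrite mulr_ge0 ?x0// ltW.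
  - exact: poly_bounded_cst.
  - by apply: poly_boundedM => //; exact: poly_bounded_cst.
  - by move=> l _; rewrite !mul1r.
  - by move=> l _; rewrite !mul1r !mulr1.
have H2 (j i : 'I_N) : first_order
    (fun t l => (1 + t * complete_sum k (tnth l i) (tnth l j)) `^ (2 * kappa))
    (fun=> 1) (fun l => 2 * kappa * complete_sum k (tnth l i) (tnth l j)).
  apply: first_order_powR.
    by apply: poly_bounded_sum => m _; exact: poly_boundedM.
  by move=> l l0; rewrite complete_sum_ge0// ltW.
apply: (first_order_eq (first_orderM
  (first_order_prod1 (index_enum 'I_N) (P := xpredT) (fun j _ => H1 j))
  (first_order_prod1 (index_enum 'I_N) (P := xpredT) (fun j _ =>
    first_order_prod1 (index_enum 'I_N) (P := fun i => (j < i)%N) (fun i _ => H2 j i))))) => //.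
  by move=> l _; rewrite mulr1.
move=> l _; rewrite mul1r mulr1; congr (_ + _).
  by rewrite !big_split /= sumrN -!mulr_sumr.
rewrite -sum_complete_sum (mulrCA kappa) mulrA mulr_sumr; apply: eq_bigr => j _.
by rewrite mulr_sumr.
Qed.

Let measurable_exprn (j : 'I_N) n : measurable_fun setT (fun l => tnth l j ^+ n).
Proof. by apply: measurable_funX; exact: measurable_tnth. Qed.

Let measurable_weight_ratio k t : measurable_fun setT (weight_ratio k t).
Proof.
apply: measurable_funM.
  apply: measurable_prod => j _; apply: measurable_funM.
    apply: measurable_funM.
      apply: (measurableT_comp (measurable_powR _)).
      by apply: measurable_funD => //; exact: measurable_funM.
    apply: measurableT_comp => //; apply: measurableT_comp => //.
    by apply: measurable_funM => //; exact: measurable_funM.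
  by apply: measurable_funD => //; apply: measurable_funM => //; exact: measurable_funM.
apply: measurable_prod => j _.
rewrite (_ : (fun l => \prod_(i < N | (j < i)%N) _) = (fun l => \prod_(i < N)
    if (j < i)%N then (1 + t * complete_sum k (tnth l i) (tnth l j)) `^ (2 * kappa) else 1)).
  apply: measurable_prod => i _; case: (j < i)%N => //.
  apply: (measurableT_comp (measurable_powR _)).
  apply: measurable_funD => //; apply: measurable_funM => //.
  by apply: measurable_sum => m; exact: measurable_funM.
by apply/funext => l; rewrite big_mkcond.
Qed.

Let is_derive_raised k t (x : R) :
  is_derive x (1 : R) (raised k t) (1 + t * (k.+1%:R * x ^+ k)).
Proof.
have dX := is_deriveX k.+1 (is_derive_id x (1 : R)).
have -> : raised k t = id + t \*: (id ^+ k.+1).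
  by apply/funext => y; rewrite /raised /= [in RHS]fctE exprfctE.
apply: (is_derive_eq (is_deriveD (is_derive_id x (1 : R)) (is_deriveZ t dX))).
by rewrite /GRing.scale /= mulr1.
Qed.

(** As [weight_ratio] contains the Jacobian, the left integral is the right one after the
    substitution x -> x + t x^(k+1) in every coordinate; hence it does not depend on t. *)
Let raised_subst k t s : 0 <= t <= 1 ->
  J (fun l => (\prod_(p <- s) \sum_(j < N) raised k t (tnth l j) ^+ p) * weight_ratio k t l)
  = J (power_sums s).
Proof.
move=> /andP[t0 t1]; congr fine; apply/esym.
pose dphi (x : R) := 1 + t * (k.+1%:R * x ^+ k).
have dphi0 x : 0 <= x -> 0 <= dphi x.
  by move=> x0; rewrite addr_ge0// !mulr_ge0// exprn_ge0.
have raised0 x : 0 <= x -> x <= raised k t x.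
  by move=> x0; rewrite lerDl mulr_ge0 ?exprn_ge0.
have cdphi : continuous dphi.
  move=> x; apply: cvgD; first exact: cvg_cst.
  do 2?[apply: cvgM; first exact: cvg_cst].
  exact: exprn_continuous.
have cphi : continuous (raised k t).
  move=> x; apply: differentiable_continuous; apply/derivable1_diffP.
  by have [] := is_derive_raised k t x.
have [mf f0 _] := admissible_power_sums s.
rewrite /laguerre_integral (@orthant_integral_subst _ _ (raised k t) dphi)//.
- apply: eq_orthant_integral => l l0; rewrite -EFinM; congr EFin.
  rewrite mulrCA weight_ratioE// mulrA; congr (_ * _ * _).
  by apply: eq_bigr => p _; apply: eq_bigr => j _; rewrite tnth_map.
- exact: continuous_measurable_fun.
- exact: continuous_measurable_fun.
- by move=> x x0; rewrite (lt_le_trans x0)// raised0// ltW.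
- by move=> x x0; rewrite dphi0// ltW.
- move=> g mg g0; apply: ge0_integral_subst_Rpos => //.
  + by rewrite /raised expr0n mulr0 addr0.
  + move=> x y x0 xy; rewrite /raised ltr_leD// ler_wpM2l//.
    by rewrite lerXn2r ?nnegrE ?(ltW xy)// (le_trans x0)// ltW.
- by apply/measurable_EFinP; apply: measurable_funM => //; exact: measurable_laguerre_weight.
- by move=> l l0; rewrite lee_fin mulr_ge0 ?f0 ?laguerre_weight_ge0.
Qed.

Lemma laguerre_loop_equation k s :
  kappa * J (power_sums (k.+1 :: s)) =
  (k.+1%:R * (1 - kappa) + kappa * a) * J (power_sums (k :: s)) +
  kappa * (\sum_(m < k.+1) J (power_sums [:: val m, (k - m)%N & s])) +
  \sum_(x <- raise_terms k s) x.1%:R * J (power_sums x.2).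
Proof.
have k0 := ltW kappa0.
(* The positive and negative parts of the first-order term. Since [a] may be negative, kappa |a| is
   added on both sides to make all coefficients nonnegative. *)
pose A l := kappa * power_sums (k.+1 :: s) l +
  (kappa * k.+1%:R + kappa * `|a|) * power_sums (k :: s) l.
pose B l := (k.+1%:R + kappa * (a + `|a|)) * power_sums (k :: s) l +
  kappa * (\sum_(m < k.+1) power_sums [:: val m, (k - m)%N & s] l) +
  \sum_(x <- raise_terms k s) x.1%:R * power_sums x.2 l.
have c1 : 0 <= kappa * k.+1%:R + kappa * `|a| by rewrite addr_ge0// mulr_ge0.
have c2 : 0 <= k.+1%:R + kappa * (a + `|a|).
  rewrite addr_ge0// mulr_ge0// -lerBlDl sub0r; by rewrite -normrN ler_norm.
have AP := @admissible_power_sums.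
have AS : admissible (fun l => \sum_(m < k.+1) power_sums [:: val m, (k - m)%N & s] l).
  by apply: admissible_sum.
have AT : admissible (fun l => \sum_(x <- raise_terms k s) x.1%:R * power_sums x.2 l).
  by apply: admissible_sum => x; exact: admissibleZ.
have AA : admissible A by apply: admissibleD; exact: admissibleZ.
have AB : admissible B.
  by apply: admissibleD => //; apply: admissibleD; exact: admissibleZ.
have : J A = J B.
  apply: (@stationary_laguerre_rintegral R N kappa a kappa0 a1 (fun t l =>
    (\prod_(p <- s) \sum_(j < N) raised k t (tnth l j) ^+ p) * weight_ratio k t l)
    (power_sums s)) => //.
  - apply: (first_order_eq (first_orderM (first_order_raised_sums k s)
      (first_order_weight_ratio k))) => // [l _|l _]; rewrite mulr1//.
    rewrite /A /B.
    under [in RHS]eq_bigr do rewrite !power_sums_cons mulrA.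
    by rewrite -mulr_suml !power_sums_cons; ring.
  - move=> t; apply: measurable_funM; last exact: measurable_weight_ratio.
    apply: measurable_prod => p _; apply: measurable_sum => j.
    apply: measurable_funX; apply: measurable_funD; first exact: measurable_tnth.
    exact: measurable_funM.
  - move=> t l /andP[t0 t1] l0; rewrite mulr_ge0//.
      rewrite prodr_ge0// => p _; rewrite sumr_ge0// => j _.
      have x0 := ltW (l0 j).
      by rewrite exprn_ge0// /raised addr_ge0// mulr_ge0// exprn_ge0.
    rewrite mulr_ge0//; rewrite prodr_ge0// => j _; last first.
      by rewrite prodr_ge0// => i _; rewrite powR_ge0.
    by rewrite !mulr_ge0 ?powR_ge0 ?expR_ge0// addr_ge0// !mulr_ge0// exprn_ge0// ltW.
  - by move=> t; exact: raised_subst.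
rewrite /A /B !laguerre_rintegralD//; try exact: admissibleZ; last first.
  by apply: admissibleD; exact: admissibleZ.
rewrite !laguerre_rintegralZ// !laguerre_rintegral_sum//; last first.
  by move=> x; exact: admissibleZ.
under [X in _ = _ + X -> _]eq_bigr do rewrite laguerre_rintegralZ//.
by move=> H; lra.
Qed.

End loop_equation.

(** * Formal moments and cumulants *)

Section formal_moment.
Context {R : realType}.
Implicit Types (kappa N a : R) (s : seq nat).

(* Moments as determined by the loop equations; [d] bounds [sumn s], which drops
   by one at each use of a loop equation. *)
Fixpoint formal_moment kappa N a (d : nat) : seq nat -> R :=
  fix go s := match s with
  | [::] => 1
  | 0%N :: s' => N * go s'
  | k.+1 :: s' => match d with
    | 0%N => 0
    | d'.+1 =>
      (k.+1%:R * (1 - kappa) + kappa * a) / kappa * formal_moment kappa N a d' (k :: s')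
      + \sum_(m < k.+1) formal_moment kappa N a d' [:: val m, (k - m)%N & s']
      + kappa^-1 * \sum_(x <- raise_terms k s') x.1%:R * formal_moment kappa N a d' x.2
    end
  end.

Lemma formal_moment0 kappa N a d s :
  formal_moment kappa N a d (0%N :: s) = N * formal_moment kappa N a d s.
Proof. by case: d. Qed.

Lemma formal_moment_nil kappa N a d : formal_moment kappa N a d [::] = 1.
Proof. by case: d. Qed.

Lemma formal_momentS kappa N a d k s : formal_moment kappa N a d.+1 (k.+1 :: s) =
  (k.+1%:R * (1 - kappa) + kappa * a) / kappa * formal_moment kappa N a d (k :: s)
  + \sum_(m < k.+1) formal_moment kappa N a d [:: val m, (k - m)%N & s]
  + kappa^-1 * \sum_(x <- raise_terms k s) x.1%:R * formal_moment kappa N a d x.2.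
Proof. by []. Qed.

Arguments formal_moment : simpl never.

(** Raising keeps the number of entries and adds k to their sum. So the raised terms of a loop
    equation for k+1 have total degree one less, which fits the fuel, and their duality exponent is
    known. *)
Lemma raise_terms_size k s x : x \in raise_terms k s ->
  size x.2 = size s /\ sumn x.2 = (sumn s + k)%N.
Proof.
elim: s x => [//|p s IH] x /=; rewrite inE => /predU1P[->/=|/mapP[y /IH[sy ny] ->]/=].
  by split=> //; rewrite addnAC.
by rewrite sy ny addnA.
Qed.

Lemma power_sum0 n (l : n.-tuple R) : power_sum l 0 = n%:R.
Proof.
by rewrite /power_sum (eq_bigr (fun=> 1)) ?sumr_const ?card_ord// => j _; rewrite expr0.
Qed.

(** Both sides obey the same recursion: an entry 0 contributes the factor p_0 = N, handled by the
    inner induction on [s], and a positive head is lowered by the loop equation divided by kappa. *)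
Lemma laguerre_mean_power_sums n kappa a d s : 0 < kappa -> -1 < kappa * a ->
  (sumn s <= d)%N ->
  laguerre_mean kappa a (@power_sums R n s) = formal_moment kappa n%:R a d s.
Proof.
move=> kappa0 a1; have Z0 := @laguerre_rintegral1_gt0 R n kappa a kappa0 a1.
pose m s := laguerre_rintegral kappa a (@power_sums R n s) /
  laguerre_rintegral kappa a (fun _ : n.-tuple R => 1).
have mE s' : laguerre_mean kappa a (@power_sums R n s') = m s'.
  rewrite /laguerre_mean /m; congr (_ / fine _).
  by apply: eq_orthant_integral => l _; rewrite mul1r.
rewrite mE {mE}; elim: d s => [|d IHd]; elim=> [|[|k] s IHs] /= sd.
1,4: by rewrite formal_moment_nil /m (_ : power_sums [::] = fun=> 1) ?divff ?gt_eqF//;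
  apply/funext => l; rewrite /power_sums big_nil.
1,3: rewrite formal_moment0 -IHs// /m mulrA; congr (_ / _).
1,2: rewrite -laguerre_rintegralZ//; [|exact: admissible_power_sums];
  by congr laguerre_rintegral; apply/funext => l; rewrite power_sums_cons power_sum0.
- by [].
have E := canRL (mulKf (lt0r_neq0 kappa0)) (laguerre_loop_equation kappa0 a1 k s).
rewrite formal_momentS {1}/m E.
have kd : (k + sumn s <= d)%N by rewrite -ltnS.
rewrite -IHd//.
under [X in _ = _ + X + _]eq_bigr => i _.
  rewrite -IHd; last by rewrite /= addnA subnKC// -ltnS.
  over.
under [X in _ = _ + _ * X]eq_big_seq => x /raise_terms_size[_ xs].
  rewrite -IHd; last by rewrite xs addnC.
  over.
rewrite /m -mulr_suml.
under [X in _ = _ + _ * X]eq_bigr do rewrite mulrA.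
rewrite -mulr_suml; field.
by rewrite !gt_eqF.
Qed.

(** Under the duality the three coefficients of the recursion are multiplied by -kappa, 1 and
    kappa^2. The exponents of the corresponding terms are lower than that of the left side by 1, 0
    and 2, so every term acquires the same power of -kappa. *)
Lemma formal_moment_duality kappa N a d s : kappa != 0 ->
  formal_moment kappa^-1 (- kappa * N) (- kappa * a) d s =
  (- kappa) ^+ (size s + sumn s) * formal_moment kappa N a d s.
Proof.
move=> k0; elim: d s => [|d IHd]; elim=> [|[|k] s IHs] /=.
1,4: by rewrite !formal_moment_nil expr0 mulr1.
1,3: by rewrite !formal_moment0 IHs addSn exprS; ring.
(* Out of fuel, both sides are the default value 0; this is why the identity holds for every [d]. *)
- by rewrite /formal_moment mulr0.
rewrite !formal_momentS; set e := (size s + sumn s)%N.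
rewrite IHd /=.
under eq_bigr => i _.
  rewrite IHd /= (_ : (_ + _)%N = (e + k).+2); last first.
    by have := ltn_ord i; rewrite /e; lia.
  over.
under [X in _ + _ * X = _]eq_big_seq => x /raise_terms_size[xn xs].
  rewrite IHd xn xs addnA -/e mulrCA.
  over.
rewrite -!mulr_sumr (_ : ((size s).+1 + (k + sumn s))%N = (e + k).+1); last by rewrite /e; lia.
rewrite (_ : ((size s).+1 + (k.+1 + sumn s))%N = (e + k).+2); last by rewrite /e; lia.
rewrite !exprS; field.
exact: k0.
Qed.

(** * Polynomial dependence on N and a, and uniqueness of the interpolant *)

Definition polynomial2 (f : R -> R -> R) :=
  exists P : {poly {poly R}}, forall N a, f N a = eval_Na P N a.

Lemma polynomial2_cst c : polynomial2 (fun _ _ => c).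
Proof. by exists c%:P%:P => N a; rewrite /eval_Na !hornerC. Qed.

Lemma polynomial2_N : polynomial2 (fun N _ => N).
Proof. by exists 'X%:P => N a; rewrite /eval_Na hornerC hornerX. Qed.

Lemma polynomial2_a : polynomial2 (fun _ a => a).
Proof. by exists 'X => N a; rewrite /eval_Na hornerX hornerC. Qed.

Lemma polynomial2D f g : polynomial2 f -> polynomial2 g ->
  polynomial2 (fun N a => f N a + g N a).
Proof. by move=> [P HP] [Q HQ]; exists (P + Q) => N a; rewrite /eval_Na !hornerD HP HQ. Qed.

Lemma polynomial2M f g : polynomial2 f -> polynomial2 g ->
  polynomial2 (fun N a => f N a * g N a).
Proof. by move=> [P HP] [Q HQ]; exists (P * Q) => N a; rewrite /eval_Na !hornerM HP HQ. Qed.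

Lemma polynomial2_sum (I : Type) (r : seq I) (P : pred I) (F : I -> R -> R -> R) :
  (forall i, polynomial2 (F i)) -> polynomial2 (fun N a => \sum_(i <- r | P i) F i N a).
Proof.
move=> H; elim: r => [|i r IH].
  by under eq_fun do under eq_fun do rewrite big_nil; exact: polynomial2_cst.
have [Pi|nPi] := boolP (P i).
  by under eq_fun do under eq_fun do rewrite big_cons Pi; exact: polynomial2D.
by under eq_fun do under eq_fun do rewrite big_cons (negbTE nPi).
Qed.

Lemma polynomial2_prod (I : Type) (r : seq I) (P : pred I) (F : I -> R -> R -> R) :
  (forall i, polynomial2 (F i)) -> polynomial2 (fun N a => \prod_(i <- r | P i) F i N a).
Proof.
move=> H; elim: r => [|i r IH].
  by under eq_fun do under eq_fun do rewrite big_nil; exact: polynomial2_cst.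
have [Pi|nPi] := boolP (P i).
  by under eq_fun do under eq_fun do rewrite big_cons Pi; exact: polynomial2M.
by under eq_fun do under eq_fun do rewrite big_cons (negbTE nPi).
Qed.

Lemma polynomial2_formal_moment kappa d s :
  polynomial2 (fun N a => formal_moment kappa N a d s).
Proof.
elim: d s => [|d IHd]; elim=> [|[|k] s IHs].
1,3,4: exact: polynomial2_cst.
1,2: exact: polynomial2M polynomial2_N IHs.
apply: polynomial2D; first apply: polynomial2D.
- apply: polynomial2M => //; apply: polynomial2M; last exact: polynomial2_cst.
  apply: polynomial2D; first exact: polynomial2_cst.
  exact: polynomial2M (polynomial2_cst _) polynomial2_a.
- by apply: polynomial2_sum => i.
- apply: polynomial2M; first exact: polynomial2_cst.
  by apply: polynomial2_sum => x; apply: polynomial2M => //; exact: polynomial2_cst.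
Qed.

Lemma poly_eq0_of_infinite_roots (A : idomainType) (P : {poly A}) (f : nat -> A) :
  injective f -> (forall n, P.[f n] = 0) -> P = 0.
Proof.
move=> finj H; apply/eqP/negPn/negP => P0.
have rP : all (root P) (map f (iota 0 (size P))).
  by apply/allP => _ /mapP[n _ ->]; rewrite rootE H.
have := max_poly_roots P0 rP.
by rewrite map_inj_uniq ?iota_uniq// size_map size_iota ltnn => /(_ isT).
Qed.

(** Positive integers a satisfy kappa a > -1, so P - Q vanishes on a grid of positive integers. The
    root count is applied twice: over {poly R} in the outer variable, then over R to each value
    obtained. *)
Lemma eval_Na_inj kappa (P Q : {poly {poly R}}) : 0 < kappa ->
  (forall (n : nat) a, (0 < n)%N -> -1 < kappa * a ->
    eval_Na P n%:R a = eval_Na Q n%:R a) -> P = Q.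
Proof.
move=> k0 H; apply/eqP; rewrite -subr_eq0; apply/eqP.
have natS_inj : injective (fun m : nat => m.+1%:R : R).
  by move=> i j /eqP; rewrite eqr_nat => /eqP[].
apply: (@poly_eq0_of_infinite_roots _ _ (fun m => m.+1%:R%:P)).
  by move=> i j /polyC_inj/natS_inj.
move=> m; apply: (poly_eq0_of_infinite_roots natS_inj) => n.
rewrite !hornerE; apply/eqP; rewrite subr_eq0; apply/eqP; apply: H => //.
by rewrite (@lt_le_trans _ _ 0)// ?ltrN10// mulr_ge0// ltW.
Qed.

(** * Cumulants of the formal moments and their duality *)

Variable n : nat.
Implicit Type p : 'I_n -> nat.

(** The fuel for a block is exactly the sum of its exponents, enough for the formal moment to agree
    with the moment of the ensemble. *)
Definition formal_cumulant kappa N a p : R :=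
  \sum_(P : {set {set 'I_n}} | finset.partition P [set: 'I_n]%SET)
     (-1) ^+ #|P|.-1 * (#|P|.-1)`!%:R *
     \prod_(B in P) formal_moment kappa N a (\sum_(i in B) p i) [seq p i | i <- enum B].

Lemma sumn_enum p (B : {set 'I_n}) : sumn [seq p i | i <- enum B] = (\sum_(i in B) p i)%N.
Proof. by rewrite sumnE big_map big_enum. Qed.

Lemma laguerre_cumulantE kappa a m p : 0 < kappa -> -1 < kappa * a ->
  laguerre_cumulant m kappa a p = formal_cumulant kappa m%:R a p.
Proof.
move=> k0 a1; apply: eq_bigr => P _; congr (_ * _); apply: eq_bigr => B _.
rewrite -laguerre_mean_power_sums ?sumn_enum//; congr laguerre_mean.
by apply/funext => l; rewrite /power_sums big_map big_enum.
Qed.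

Lemma polynomial2_formal_cumulant kappa p :
  polynomial2 (fun N a => formal_cumulant kappa N a p).
Proof.
apply: polynomial2_sum => P; apply: polynomial2M; first exact: polynomial2_cst.
by apply: polynomial2_prod => B; exact: polynomial2_formal_moment.
Qed.

Lemma formal_cumulant_duality kappa N a p : kappa != 0 ->
  formal_cumulant kappa^-1 (- kappa * N) (- kappa * a) p =
  (- kappa) ^+ (n + \sum_(i < n) p i) * formal_cumulant kappa N a p.
Proof.
move=> k0; rewrite mulr_sumr; apply: eq_bigr => P partP.
rewrite [RHS]mulrCA; congr (_ * _).
under eq_bigr do rewrite formal_moment_duality// sumn_enum size_map -cardE.
(* The blocks of a partition are disjoint and cover all indices, so their sizes add up to n and
   their exponent sums to the total of p; the power of -kappa is the same for every partition. *)
rewrite big_split /= prodrXr big_split /=; congr (_ ^+ (_ + _) * _).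
  by rewrite -(card_partition partP) cardsT card_ord.
case/and3P: partP => /eqP cP tP _.
by rewrite -finset.big_trivIset// cP big_mkcond; apply: eq_bigr => i _; rewrite inE.
Qed.

(** The second conclusion holds for all real N and a, beyond the range where the ensemble exists;
    this is what lets [muL] be evaluated at the dual parameters. *)
Lemma laguerre_interpolant_exists kappa p : 0 < kappa ->
  exists2 P, laguerre_interpolant kappa p P &
    forall N a, eval_Na P N a = formal_cumulant kappa N a p.
Proof.
move=> k0; have [P HP] := polynomial2_formal_cumulant kappa p.
by exists P => // m a _ a1; rewrite laguerre_cumulantE.
Qed.

Lemma laguerre_interpolant_unique kappa p P Q : 0 < kappa ->
  laguerre_interpolant kappa p P -> laguerre_interpolant kappa p Q -> P = Q.
Proof.
by move=> k0 HP HQ; apply: (eval_Na_inj k0) => m a m0 a1; rewrite -HP// HQ.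
Qed.

(** By uniqueness, the polynomial chosen by [xget] is the one built from the formal cumulant. *)
Lemma muLE kappa N a p : 0 < kappa -> muL N kappa a p = formal_cumulant kappa N a p.
Proof.
move=> k0; have [P HP EP] := laguerre_interpolant_exists p k0.
rewrite -EP /muL; congr eval_Na.
exact: (laguerre_interpolant_unique k0 (xgetPex 0 (ex_intro _ P HP)) HP).
Qed.

Lemma muL_duality kappa N a p : 0 < kappa ->
  muL N kappa a p = (- kappa) ^- (n + \sum_(i < n) p i) *
    muL (- kappa * N) kappa^-1 (- kappa * a) p.
Proof.
move=> k0; rewrite !muLE ?invr_gt0// formal_cumulant_duality ?gt_eqF// mulKf//.
by rewrite expf_neq0// oppr_eq0 gt_eqF.
Qed.

End formal_moment.

(** The first component certifies that the choice made in [muL] designates a single polynomial, so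
    the two identities concern the genuine extension of the cumulants. *)
Theorem proposition3p3 (R : realType) (n : nat) (kappa : R)
    (hn : (0 < n)%N) (hkappa : 0 < kappa) :
  [/\ forall p : 'I_n -> nat,
        exists! P : {poly {poly R}}, laguerre_interpolant kappa p P,
      forall N a : R,
        WL n N kappa a =
        scale_vars (- kappa) (WL n (- kappa * N) kappa^-1 (- kappa * a))
    & forall (N a : R) (p : 'I_n -> nat),
        muL N kappa a p =
        (- kappa) ^- (n + \sum_(l < n) p l) *
        muL (- kappa * N) kappa^-1 (- kappa * a) p].
Proof.
split=> [p|N a|N a p]; last exact: muL_duality.
  have [P HP _] := laguerre_interpolant_exists p hkappa.
  by exists P; split=> // Q; exact: laguerre_interpolant_unique.
apply/funext => k; rewrite /scale_vars /WL.
case: ifPn => [/forallP k0|_]; last by rewrite mulr0.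
rewrite muL_duality//; congr (_ ^- _ * _).
(* Each exponent of the series is one more than the power-sum index, because of the prefactor 1 /
   (x_1 ... x_n); these n units are the n in the exponent of -kappa. *)
rewrite -[X in (X + _)%N]card_ord -sum1_card -big_split /=; apply: eq_bigr => i _.
by rewrite add1n prednK.
Qed.
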